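(* Let $G$ be a connected bi-directed digraph with no self-loop. The hike poset $P_G$ determines $G$ uniquely up to isomorphism, unless $G\in\{K_3,K_{1,5}\}$. That is, if $G$ is a connected finite bi-directed digraph with no self-loop which is not isomorphic to (the bi-directed version of) $K_3$ or $K_{1,5}$, and $G'$ is a connected finite bi-directed digraph with no self-loop such that the posets $P_G$ and $P_{G'}$ are isomorphic, then $G'$ is isomorphic to $G$.
   Context: All graphs are finite. A bi-directed digraph is one whose arc set $E\subseteq V^2$ satisfies $(v_i,v_j)\in E$ if and only if $(v_j,v_i)\in E$, i.e. the digraph obtained from an undirected graph by replacing each undirected edge with two arcs of opposite directions. $K_3$ is the complete graph on 3 vertices and $K_{1,5}$ the complete bipartite graph on 1 and 5 vertices. Each arc $(v_i,v_j)$ is identified with a letter $w_{ij}$. Let $\mathcal M$ be the trace monoid generated by the arcs, i.e. the quotient of the free monoid on the arcs by the relations $w_{ij}w_{kl}=w_{kl}w_{ij}$ for $i\neq k$. A hike is an element $h=w_{i_1j_1}\cdots w_{i_\ell j_\ell}$ of $\mathcal M$ such that for each $i$, $\#\{k: i_k=i\}=\#\{k: j_k=i\}$. The hikes form a submonoid $\mathcal H$ of $\mathcal M$, containing the empty hike $1$. $P_G$ is the set $\mathcal H$ partially ordered by left division: $h\prec h'$ if and only if $h'=h.h''$ for some $h''\in\mathcal H$. *)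

(* Defs.v *)
From HB Require Import structures.
From mathcomp Require Import all_boot all_order.
From mathcomp Require Import boolp.

Set Implicit Arguments.
Unset Strict Implicit.
Unset Printing Implicit Defensive.

Import Order.TTheory.
Local Open Scope group_scope.
Local Open Scope quotient_scope.

(* A digraph is a finite type of vertices V with a relation E : rel V.        *)

Definition bidirected (V : finType) (E : rel V) := symmetric E.

Definition loopless (V : finType) (E : rel V) := irreflexive E.

(* The graph without vertices is not connected: it would otherwise have the   *)
(* same (one-element) hike poset as the graph with one vertex.                *)
Definition connected (V : finType) (E : rel V) :=
  (0 < #|V|)%N /\ forall x y : V, connect E x y.

Definition digraph_iso (V V' : finType) (E : rel V) (E' : rel V') :=
  exists f : V -> V', bijective f /\ {mono f : x y / E x y >-> E' x y}.

Definition complete (n : nat) : rel 'I_n := fun x y => x != y.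

Definition is_inl (A B : Type) (x : A + B) := if x is inl _ then true else false.

Definition complete_bipartite (m n : nat) : rel ('I_m + 'I_n)%type :=
  fun x y => is_inl x != is_inl y.

Fact hike_display : Order.disp_t.
Proof. exact: Order.Disp tt tt. Qed.

Section Hikes.
Variables (V : finType) (E : rel V).

Definition arc := {p : V * V | E p.1 p.2}.
HB.instance Definition _ := Finite.on arc.

Definition tail (a : arc) : V := (val a).1.
Definition head (a : arc) : V := (val a).2.

(* The congruence on the free monoid of words generated by the commutation    *)
(* of arcs with different tails.                                              *)
Inductive trace_eq : seq arc -> seq arc -> Prop :=
| trace_eq_comm a b : tail a != tail b -> trace_eq [:: a; b] [:: b; a]
| trace_eq_refl u : trace_eq u u
| trace_eq_sym u v : trace_eq u v -> trace_eq v u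
| trace_eq_trans v u w : trace_eq u v -> trace_eq v w -> trace_eq u w
| trace_eq_cat u u' v v' :
    trace_eq u u' -> trace_eq v v' -> trace_eq (u ++ v) (u' ++ v').

Definition trace_eqb : rel (seq arc) := fun u v => `[< trace_eq u v >].

Lemma trace_eqb_refl : reflexive trace_eqb.
Proof. by move=> u; apply/asboolP/trace_eq_refl. Qed.

Lemma trace_eqb_sym : symmetric trace_eqb.
Proof. by move=> u v; apply/asboolP/asboolP; apply: trace_eq_sym. Qed.

Lemma trace_eqb_trans : transitive trace_eqb.
Proof.
move=> v u w /asboolP uv /asboolP vw.
by apply/asboolP; apply: trace_eq_trans uv vw.
Qed.

Canonical trace_equiv :=
  EquivRel trace_eqb trace_eqb_refl trace_eqb_sym trace_eqb_trans.

Definition trace := {eq_quot trace_equiv}.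
HB.instance Definition _ := EqQuotient.on trace.
HB.instance Definition _ := Choice.on trace.

Lemma trace_eqP (u v : seq arc) :
  trace_eq u v <-> \pi_trace u = \pi_trace v.
Proof.
by split=> [/asboolP uv|/eqmodP/asboolP //]; apply/eqmodP.
Qed.

Definition trace1 : trace := \pi_trace [::].

Definition trace_mul (x y : trace) : trace := \pi_trace (repr x ++ repr y).

Lemma trace_mul_pi (u v : seq arc) :
  trace_mul (\pi_trace u) (\pi_trace v) = \pi_trace (u ++ v).
Proof. by apply/trace_eqP/trace_eq_cat; apply/trace_eqP; rewrite reprK. Qed.

Lemma trace_mulA : associative trace_mul.
Proof.
move=> x y z; rewrite -[x]reprK -[y]reprK -[z]reprK.
move: (repr x) (repr y) (repr z) => u v w.
by rewrite (trace_mul_pi v w) (trace_mul_pi u v) 2!trace_mul_pi catA.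
Qed.

Lemma trace_mul1 : left_id trace1 trace_mul.
Proof. by move=> x; rewrite -[x]reprK trace_mul_pi. Qed.

Lemma trace_mulr1 : right_id trace1 trace_mul.
Proof. by move=> x; rewrite -[x]reprK trace_mul_pi cats0. Qed.

HB.instance Definition _ :=
  isMonoid.Build trace trace_mulA trace_mul1 trace_mulr1.

Lemma pi_cat (u v : seq arc) :
  \pi_trace (u ++ v) = \pi_trace u * \pi_trace v.
Proof. by rewrite -trace_mul_pi. Qed.

Definition balanced (w : seq arc) :=
  forall i : V, count (fun a => tail a == i) w = count (fun a => head a == i) w.

Definition is_hike : pred trace :=
  fun h => `[< exists2 w : seq arc, h = \pi_trace w & balanced w >].

Lemma is_hike_closed : monoid_closed is_hike.
Proof.
split=> [|x y /asboolP[u -> bu] /asboolP[v -> bv]]; apply/asboolP.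
  by exists [::].
by exists (u ++ v) => [|i]; rewrite ?pi_cat // !count_cat bu bv.
Qed.

Definition hike := {h : trace | is_hike h}.
HB.instance Definition _ := SubChoice.on hike.
HB.instance Definition _ :=
  SubChoice_isSubMonoid.Build trace is_hike hike is_hike_closed.

Definition hike_le : rel hike :=
  fun h h' => `[< exists h'' : hike, h' = h * h'' >].

Lemma trace_eq_size (u v : seq arc) : trace_eq u v -> size u = size v.
Proof.
elim=> // [{}v u' w _ -> _ -> //|{}u u' {}v v' _ su _ sv].
by rewrite !size_cat su sv.
Qed.

Definition trace_len (x : trace) : nat := size (repr x).

Lemma trace_lenM (x y : trace) :
  trace_len (x * y) = (trace_len x + trace_len y)%N.
Proof.
by rewrite /trace_len -size_cat; apply/trace_eq_size/trace_eqP; rewrite reprK.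
Qed.

Lemma trace_len_eq0 (x : trace) : trace_len x = 0%N -> x = 1.
Proof. by move=> /size0nil x0; rewrite -[x]reprK x0. Qed.

Lemma hike_le_refl : reflexive hike_le.
Proof. by move=> h; apply/asboolP; exists 1; rewrite mulg1. Qed.

Lemma hike_le_anti : antisymmetric hike_le.
Proof.
move=> h h' /andP[/asboolP[k h'E] /asboolP[l hE]].
have lenE : (trace_len (val h) + trace_len (val k) + trace_len (val l))%N
    = trace_len (val h) by rewrite -!trace_lenM -2!valM -h'E -hE.
have k1 : k = 1.
  apply/val_inj; rewrite val1; apply: trace_len_eq0; apply/eqP.
  by move/eqP: lenE; rewrite -addnA -[X in _ == X]addn0 eqn_add2l addn_eq0
     => /andP[].
by rewrite h'E k1 mulg1.
Qed.

Lemma hike_le_trans : transitive hike_le.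
Proof.
move=> h2 h1 h3 /asboolP[k h2E] /asboolP[l h3E]; apply/asboolP.
by exists (k * l); rewrite mulgA -h2E.
Qed.

HB.instance Definition _ := Order.Le_isPOrder.Build
  hike_display hike hike_le_refl hike_le_anti hike_le_trans.

Lemma hike_leP (h h' : hike) :
  (h <= h')%O <-> exists h'' : hike, h' = h * h''.
Proof. by split=> /asboolP. Qed.

End Hikes.

Definition hike_poset (V : finType) (E : rel V) : porderType hike_display := hike E.

Definition poset_iso d d' (P : porderType d) (Q : porderType d') :=
  exists f : P -> Q, bijective f /\ {mono f : x y / (x <= y)%O}.

(* Main.v *)
(* The trace monoid is a product of free monoids, one per vertex, since arcs  *)
(* with different tails commute: a hike is a family of words ("stacks"),      *)
(* and left division compares all stacks by prefix. The atoms of the hike     *)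
(* poset are the simple cycles, and two distinct atoms have a common upper    *)
(* bound exactly when they are vertex-disjoint; so the poset determines the   *)
(* intersection graph of the simple cycles (edges, and both orientations of   *)
(* the longer cycles). Call two cycles twins when they meet the same cycles.  *)
(* Unless G is K_3, the number of edges in each class of twins can be read    *)
(* off this intersection graph, hence so can the line graph of G. Whitney's   *)
(* theorem then recovers G. If G' is K_3, then G has five pairwise meeting    *)
(* simple cycles, so it is K_3 or K_{1,5}.                                    *)

From HB Require Import structures.
From mathcomp Require Import all_boot all_order.
From mathcomp Require Import fingroup perm boolp generic_quotient.
Require Import Defs.
Set Implicit Arguments.
Unset Strict Implicit.
Unset Printing Implicit Defensive.
Import Order.TTheory.

(** A hike is determined by its stacks, and [hike_le_stack] turns left division into the prefix
    order on them. Hence the atoms are the simple cycles ([atomP]), and distinct cycles have a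
    common upper bound iff they are disjoint ([cyc_hike_compat]). Both notions are order-theoretic,
    so an isomorphism of hike posets gives a bijection of cycles preserving intersection
    ([poset_iso_cyc]).

    It remains to recognise the edges of G in the intersection graph of its cycles. This cannot be
    done cycle by cycle, since an edge and a longer cycle may be twins; but twins are
    interchangeable, so it is enough to count the edges in each class ([star_count]). Longer cycles
    come in pairs of opposite orientations, so the size of a class has the parity of its number of
    edges; [simplicial_edge] and [twin_edges] bound that number tightly enough for parity to decide.
    Matching classes then yields an isomorphism of line graphs ([same_intersections_line_iso]), and
    [whitney] recovers the graph, K_3 being excluded on both sides.

    If G' is K_3, all cycles of G meet pairwise. Unless G is K_3 too, they are then all edges, five
    in number, and form the star K_{1,5} ([complete3_partner]). *)

Definition atom disp (P : porderType disp) (x : P) :=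
  ~ (forall y, (x <= y)%O) /\
  forall y, (y <= x)%O -> (forall z, (y <= z)%O) \/ y = x.

(** * Hikes as families of stacks *)

Section Stacks.
Local Open Scope group_scope.
Local Open Scope quotient_scope.
Variables (V : finType) (E : rel V).
Implicit Types (u v w : seq (arc E)) (h : hike E) (i : V).

Definition stack i w := [seq a <- w | tail a == i].

Lemma trace_eq_move (a : arc E) u :
  stack (tail a) u = [::] -> trace_eq (u ++ [:: a]) (a :: u).
Proof.
elim: u => [|b u IHu] /=; first by move=> _; apply: trace_eq_refl.
case: ifP => // ba /IHu ua; apply: (@trace_eq_trans _ _ ([:: b] ++ a :: u)).
  by apply: (@trace_eq_cat _ _ [:: b]) ua; apply: trace_eq_refl.
apply: (@trace_eq_cat _ _ [:: b; a] [:: a; b]); last exact: trace_eq_refl.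
by apply: trace_eq_comm; rewrite ba.
Qed.

(* Two arcs commute exactly when their tails differ, so a trace is the        *)
(* independent data, for each vertex, of the word of the arcs leaving it.     *)
Lemma trace_eq_stack u v : trace_eq u v <-> forall i, stack i u = stack i v.
Proof.
split.
  elim=> // [a b ab i|{}u {}v w _ uv _ vw i|u1 u2 v1 v2 _ u12 _ v12 i].
  - rewrite /stack /=; case: eqP => // <-.
    by rewrite eq_sym (negbTE ab).
  - by rewrite uv.
  - by rewrite /stack !filter_cat -/(stack i u1) u12 -/(stack i v1) v12.
elim: u v => [|a u IHu] v eq_uv.
  case: v eq_uv => [|b v] eq_uv; first exact: trace_eq_refl.
  by have := eq_uv (tail b); rewrite /stack /= eqxx.
have /= := eq_uv (tail a); rewrite eqxx => eq_a.
(* The first arc of [v] with the tail of [a] is [a] itself, and all that precedes it commutes with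
   [a]. *)
have [v1 [v2 [def_v v1a]]] : exists v1 v2,
    v = v1 ++ a :: v2 /\ stack (tail a) v1 = [::].
  elim: v eq_a {eq_uv} => //= b v IHv; case: ifP => ba.
    by case=> <- _; exists [::], v.
  by case/IHv=> v1 [v2 [-> v1a]]; exists (b :: v1), v2; rewrite /= ba.
apply: (@trace_eq_trans _ _ (a :: v1 ++ v2)).
  apply: (@trace_eq_cat _ _ [:: a] [:: a]); first exact: trace_eq_refl.
  apply: IHu => i; have := eq_uv i.
  rewrite def_v /stack /= !filter_cat /=; case: eqP => [<- |//].
  by rewrite -!/(stack _ _) v1a => -[].
rewrite def_v -(cat1s a v2) catA -cat_cons.
by apply/trace_eq_sym/trace_eq_cat; [apply: trace_eq_move|apply: trace_eq_refl].
Qed.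

Definition word h := repr (val h).

Lemma stack_pi w i : stack i (repr (\pi_(trace E) w)) = stack i w.
Proof.
suff /trace_eq_stack: trace_eq (repr (\pi_(trace E) w)) w by [].
by apply/trace_eqP; rewrite reprK.
Qed.

Lemma stack_wordM h h' i :
  stack i (word (h * h')) = stack i (word h) ++ stack i (word h').
Proof. by rewrite /word valM stack_pi /stack filter_cat. Qed.

Lemma hike_eqP h h' : (forall i, stack i (word h) = stack i (word h')) -> h = h'.
Proof.
move=> hh'; apply/val_inj; rewrite -[val h]reprK -[val h']reprK.
exact/trace_eqP/trace_eq_stack.
Qed.

Lemma count_stack (p : pred (arc E)) w :
  count p w = \sum_i count p (stack i w).
Proof.
elim: w => [|a w IHw]; first by rewrite big1.
rewrite /= IHw [RHS](eq_bigr (fun i => (p a && (tail a == i)) + count p (stack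
  i w))%N).
  rewrite big_split /=; congr (_ + _)%N.
  rewrite (bigD1 (tail a)) //= eqxx andbT big1 ?addn0 // => i ai.
  by rewrite eq_sym (negbTE ai) andbF.
by move=> i _; rewrite /stack /=; case: ifP => /=; rewrite (andbT, andbF).
Qed.

(** Balance only counts arcs, and the stacks retain these counts; so it passes to every
    representative of a trace. *)
Lemma balanced_stack u v : (forall i, stack i u = stack i v) ->
  balanced u -> balanced v.
Proof.
move=> uv bu; have count_uv p : count p v = count p u.
  by rewrite !count_stack; apply: eq_bigr => i _; rewrite uv.
by move=> i; rewrite !count_uv bu.
Qed.

Lemma balanced_word h : balanced (word h).
Proof.
have /asboolP[w hw bw] := valP h; apply: (balanced_stack _ bw) => i.
by rewrite /word hw stack_pi.
Qed.

Definition hike_of w (bw : balanced w) : hike E :=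
  Sub (\pi_(trace E) w)
    (introT (asboolP _) (ex_intro2 _ _ w erefl bw)).

Lemma stack_hike_of w (bw : balanced w) i :
  stack i (word (hike_of bw)) = stack i w.
Proof. exact: stack_pi. Qed.

(** For the converse, the quotient consists of what remains of each stack of [h'], the vertices
    being taken in any order; it is a hike because balance can be cancelled. *)
Lemma hike_le_stack h h' :
  (h <= h')%O <-> forall i, prefix (stack i (word h)) (stack i (word h')).
Proof.
split=> [/hike_leP[k ->] i|le_hh'].
  by rewrite stack_wordM prefix_prefix.
pose rest i := drop (size (stack i (word h))) (stack i (word h')).
pose w := flatten [seq rest i | i <- enum V].
have stack_w i : stack i w = rest i.
  have stack_rest j : stack i (rest j) = if j == i then rest j else [::].
    have: all (fun a => tail a == j) (rest j).
      by apply/allP => a /mem_drop; rewrite mem_filter => /andP[].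
    elim: (rest j) => /= [|a s IHs]; first by rewrite if_same.
    by case/andP=> /eqP aj /IHs; rewrite /stack /= aj => ->; case: (j == i).
  rewrite /w; have := mem_enum V i; have := enum_uniq V.
  elim: (enum V) => //= j s IHs /andP[js us]; rewrite inE /stack filter_cat.
  rewrite -!/(stack _ _) stack_rest; case: (eqVneq i j) => [ij _ | ij /= ri].
    have {us js IHs} iNs : i \notin s by rewrite ij.
    suff ->: stack i (flatten (map rest s)) = [::] by rewrite -ij cats0.
    elim: s iNs => //= k s IHs; rewrite inE negb_or => /andP[ik /IHs].
    rewrite /stack filter_cat => -> .
    by rewrite -!/(stack _ _) stack_rest eq_sym (negbTE ik).
  exact: IHs.
have cat_w i : stack i (word h ++ w) = stack i (word h').
  rewrite /stack filter_cat -!/(stack _ _) stack_w /rest.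
  by have /prefixP[s ->] := le_hh' i; rewrite drop_size_cat.
have bw : balanced w.
  have := balanced_stack (fun i => esym (cat_w i)) (balanced_word h').
  by move=> + i => /(_ i); rewrite !count_cat balanced_word => /addnI.
apply/hike_leP; exists (hike_of bw); apply: hike_eqP => i.
by rewrite stack_wordM stack_hike_of -cat_w /stack filter_cat.
Qed.

End Stacks.

(** * Atoms of the hike poset *)

Section Cycles.
Local Open Scope group_scope.
Variables (V : finType) (E : rel V).

Definition supp (s : {perm V}) : {set V} := [set x | s x != x].

(** The permutation moves each vertex of the cycle to the next one. Rotations of a cycle are thus
    identified, the two orientations of a longer cycle stay distinct, and an edge is a
    transposition. *)
Definition is_cycle (s : {perm V}) :=
  [&& s != 1, [forall x in supp s, E x (s x)]
    & [forall x in supp s, supp s \subset porbit s x]].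

Definition cyc := {s : {perm V} | is_cycle s}.
HB.instance Definition _ := Finite.on cyc.

Implicit Types (s t : {perm V}) (c d : cyc).

Lemma supp_perm s x : x \in supp s -> s x \in supp s.
Proof. by rewrite !inE (inj_eq perm_inj). Qed.

Lemma cyc_edge c x : x \in supp (val c) -> E x (val c x).
Proof. by case/and3P: (valP c) => _ /'forall_implyP cE _ /cE. Qed.

Lemma cyc_orbit c x : x \in supp (val c) -> supp (val c) \subset porbit (val c) x.
Proof. by case/and3P: (valP c) => _ _ /'forall_implyP cE /cE. Qed.

Lemma supp_neq0 c : supp (val c) != set0.
Proof.
case/and3P: (valP c) => c1 _ _; apply: contraNneq c1 => c0.
apply/eqP/permP => x; rewrite perm1; apply/eqP/negPn.
by have := in_set0 x; rewrite -c0 inE => ->.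
Qed.

Definition meets (A B : {set V}) := [exists x, (x \in A) && (x \in B)].

Lemma meetsP (A B : {set V}) : reflect (exists2 x, x \in A & x \in B) (meets A B).
Proof.
by apply: (iffP existsP) => [[x /andP[]]|[x xA xB]]; exists x; rewrite ?xA.
Qed.

(** From [x], both permutations run through the same orbit, and neither moves anything outside
    it. *)
Lemma cyc_ext c d x :
  x \in supp (val c) -> {in supp (val c), val d =1 val c} -> d = c.
Proof.
move=> xc dc; have orb y : y \in supp (val c) ->
    exists k, y = (val c ^+ k) x /\ y = (val d ^+ k) x.
  move=> /(subsetP (cyc_orbit xc))/porbitP[k ->]; exists k; split=> //.
  elim: k => [|k IHk]; first by rewrite !expg0.
  rewrite !expgSr !permM -IHk dc //.
  elim: k {IHk} => [|k IHk]; first by rewrite expg0 perm1.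
  by rewrite expgSr permM supp_perm.
apply/val_inj/permP => y; case: (boolP (y \in supp (val c))) => [/dc //|yc].
suff yd: y \notin supp (val d).
  by move: yc yd; rewrite !inE !negbK => /eqP-> /eqP.
apply: contra yc => yd.
have xd : x \in supp (val d) by rewrite inE dc // -[_ == _]negbK; move: xc;
  rewrite inE => ->.
case/porbitP: (subsetP (cyc_orbit xd) y yd) => k ->.
elim: k => [|k IHk]; first by rewrite expg0 perm1.
by rewrite expgSr permM dc // supp_perm.
Qed.

Hypothesis loopE : irreflexive E.

Definition cyc_word s : seq (arc E) := pmap insub [seq (i, s i) | i <- enum V].

Lemma tail_insub x y (a : arc E) : insub (x, y) = Some a -> tail a = x.
Proof. by case: insubP => // b _ bE [<-]; rewrite /tail bE. Qed.

Lemma stack_cyc_word s i :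
  stack i (cyc_word s) = if insub (i, s i) is Some a then [:: a] else [::].
Proof.
rewrite /cyc_word; have := mem_enum V i; have := enum_uniq V.
elim: (enum V) => //= j r IHr /andP[jr ur]; rewrite inE.
case: (eqVneq i j) => [ij _ | ij /= ir].
  have r0 : stack i (pmap insub [seq (k, s k) | k <- r]) = [::] :> seq (arc E).
    rewrite ij; elim: r jr {IHr ur} => //= k r IHr.
    rewrite inE negb_or => /andP[jk /IHr r0].
    case ea : (insub _) => [a|] //=.
    by rewrite (tail_insub ea) eq_sym (negbTE jk).
  subst j; case ea : (insub _) => [a|] //=.
  by rewrite (tail_insub ea) eqxx r0.
case ea : (insub (j, _)) => [a|] /=; last exact: IHr.
by rewrite (tail_insub ea) eq_sym (negbTE ij) IHr.
Qed.

Lemma balanced_cyc_word c : balanced (cyc_word (val c)).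
Proof.
set s := val c.
have EsP x : E x (s x) = (s x != x).
  apply/idP/idP=> [Exs|xs]; last by apply: cyc_edge; rewrite inE.
  by apply: contraTneq Exs => ->; rewrite loopE.
have cnt (p : pred (arc E)) : count p (cyc_word s) =
    \sum_j (if insub (j, s j) is Some a then (p a : nat) else 0%N).
  rewrite count_stack; apply: eq_bigr => j _; rewrite stack_cyc_word.
  by case: (insub _) => //= a; rewrite addn0.
(* Only the arc leaving [i] has tail [i], and only the arc leaving [s^-1 i] can have head [i]. *)
move=> i; rewrite !cnt (bigD1 i) //= [RHS](bigD1 (s^-1 i)) //=.
rewrite [X in (_ + X)%N]big1 => [|j ji]; last first.
  by case ea : (insub _) => [a|] //; rewrite (tail_insub ea) (negbTE ji).
rewrite [X in (_ = _ + X)%N]big1 => [|j ji]; last first.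
  case: insubP => // a _ aE; rewrite /head aE /=.
  by apply/eqP; rewrite eqb0; apply: contraNneq ji => <-; rewrite permK.
have siE : (i != s^-1 i) = (s i != i).
  by rewrite -(inj_eq (@perm_inj _ s)) permKV.
congr (_ + _)%N; case: insubP => [a Ea aE|].
  move: Ea; rewrite /tail aE /= eqxx EsP => si.
  case: insubP => [b _ bE|]; first by rewrite /head bE permKV /= eqxx.
  by rewrite /= EsP permKV siE si.
rewrite /= EsP => si; case: insubP => // b.
by rewrite /= EsP permKV siE (negbTE si).
Qed.

Definition cyc_hike c : hike E := hike_of (balanced_cyc_word c).

Lemma stack_cyc_hike c i : stack i (word (cyc_hike c)) =
  if insub (i, val c i) is Some a then [:: a] else [::].
Proof. by rewrite stack_hike_of stack_cyc_word. Qed.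

Lemma stack_cyc_supp c i : i \in supp (val c) ->
  exists2 a, stack i (word (cyc_hike c)) = [:: a] & val a = (i, val c i).
Proof.
move=> /cyc_edge Eic; rewrite stack_cyc_hike.
by case: insubP => [a _ aE|]; [exists a | rewrite /= Eic].
Qed.

Lemma stack_cyc_nsupp c i : i \notin supp (val c) ->
  stack i (word (cyc_hike c)) = [::].
Proof.
rewrite inE negbK stack_cyc_hike => /eqP ci.
by case: insubP => //= a; rewrite ci loopE.
Qed.

Lemma hike1_le (h : hike E) : ((1 : hike E) <= h)%O.
Proof. by apply/hike_leP; exists h; rewrite mul1g. Qed.

Lemma cyc_hike_neq1 c : cyc_hike c <> 1.
Proof.
have [x xc] := set0Pn _ (supp_neq0 c); move=> c1.
have [a] := stack_cyc_supp xc; rewrite c1.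
by rewrite /word val1 stack_pi.
Qed.

(* Simple cycles have stacks of height at most one, so below a common hike    *)
(* they leave each shared vertex by the same arc.                             *)
Lemma cyc_hike_ub c d (h : hike E) :
  (cyc_hike c <= h)%O -> (cyc_hike d <= h)%O ->
  meets (supp (val c)) (supp (val d)) -> c = d.
Proof.
move=> /hike_le_stack ch /hike_le_stack dh /meetsP[x xc xd].
have agree y : y \in supp (val c) -> y \in supp (val d) -> val c y = val d y.
  move=> /stack_cyc_supp[a sa aE] /stack_cyc_supp[b sb bE].
  move: (ch y) (dh y); rewrite sa sb.
  case: (stack y (word h)) => //= e l /andP[/eqP ae _] /andP[/eqP be _].
  by move: aE; rewrite ae -be bE => -[].
have orb k : (val c ^+ k) x = (val d ^+ k) x /\
    (val c ^+ k) x \in supp (val c) :&: supp (val d).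
  elim: k => [|k [eqk]]; first by rewrite !expg0 perm1 inE xc xd.
  rewrite inE => /andP[kc kd]; rewrite !expgSr !permM -eqk agree //.
  by rewrite inE supp_perm // -agree // supp_perm.
apply: (cyc_ext xd) => y /(subsetP (cyc_orbit xd))/porbitP[k ->].
have [eqk] := orb k; rewrite inE -eqk => /andP[kc kd].
exact: agree.
Qed.

Lemma cyc_hike_inj : injective cyc_hike.
Proof.
move=> c d cd; have [x xc] := set0Pn _ (supp_neq0 c).
apply: (@cyc_hike_ub _ _ (cyc_hike d)); rewrite ?cd //.
apply/meetsP; exists x => //; apply: contraT => /stack_cyc_nsupp.
by rewrite -cd; have [a ->] := stack_cyc_supp xc.
Qed.

Lemma cyc_hike_le c d : (cyc_hike c <= cyc_hike d)%O -> c = d.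
Proof.
move=> cd; have [x xc] := set0Pn _ (supp_neq0 c).
apply: (cyc_hike_ub cd) => //; apply/meetsP; exists x => //.
apply: contraT => /stack_cyc_nsupp dx.
have /hike_le_stack/(_ x) := cd; rewrite dx.
by have [a ->] := stack_cyc_supp xc.
Qed.

(** Disjoint cycles commute, so their product lies above both. *)
Lemma cyc_hike_disjoint_ub c d : ~~ meets (supp (val c)) (supp (val d)) ->
  exists h : hike E, (cyc_hike c <= h)%O && (cyc_hike d <= h)%O.
Proof.
move=> Ncd; exists (cyc_hike c * cyc_hike d).
have ->: (cyc_hike c <= cyc_hike c * cyc_hike d)%O.
  by apply/hike_leP; exists (cyc_hike d).
apply/hike_leP; exists (cyc_hike c); apply: hike_eqP => i.
rewrite !stack_wordM; case: (boolP (i \in supp (val c))) => ic.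
  rewrite (stack_cyc_nsupp (c := d)) ?cats0 //.
  by apply: contra Ncd => id; apply/meetsP; exists i.
by rewrite (stack_cyc_nsupp ic) cats0.
Qed.

Lemma hike_le1 (h : hike E) : (h <= (1 : hike E))%O -> h = 1.
Proof. by move=> h1; apply: le_anti; rewrite h1 hike1_le. Qed.

(* Following the bottom arcs of the stacks of a non-trivial hike never leaves *)
(* the set of non-empty stacks, hence eventually runs around a cycle.         *)
Lemma cyc_below (h : hike E) : h <> 1 -> exists c, (cyc_hike c <= h)%O.
Proof.
move=> hn1.
pose f i := if stack i (word h) is a :: _ then head a else i.
pose N := [set i | stack i (word h) != [::]].
have fE i : i \in N -> exists (a : arc E) l,
    stack i (word h) = a :: l /\ val a = (i, f i).
  rewrite inE /f; case sE : (stack i (word h)) => [//|a l] _; exists a, l.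
  split=> //; have: a \in stack i (word h) by rewrite sE mem_head.
  by rewrite mem_filter => /andP[/eqP <- _];
    rewrite /tail /head -surjective_pairing.
have fN i : i \in N -> f i \in N.
  move=> iN; have [a [l [sa aE]]] := fE i iN; rewrite inE.
  have: a \in word h.
    have: a \in stack i (word h) by rewrite sa mem_head.
    by rewrite mem_filter => /andP[].
  move=> ah; have: has (fun b => head b == f i) (word h).
    by apply/hasP; exists a => //; rewrite /head aE.
  (* By balance, a vertex that some arc enters is also left by some arc. *)
  rewrite has_count -balanced_word -has_count => /hasP[b bh btl].
  have: b \in stack (f i) (word h) by rewrite mem_filter btl.
  by apply: contraTneq => ->.
have Ef i : i \in N -> E i (f i).
  by move=> /fE[a [l [_ aE]]]; have := valP a; rewrite aE.
have [x xN] : exists x, x \in N.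
  apply/existsP; apply: contraT => /existsPn N0; case: hn1.
  apply: hike_eqP => i; rewrite {2}/word val1 stack_pi /=.
  by have := N0 i; rewrite inE negbK => /eqP.
have itN k z : z \in N -> iter k f z \in N.
  by elim: k => //= k IHk /IHk /fN.
(* Iterates of [f] in a finite set repeat, so the walk from [x] reaches a periodic point. *)
have [z zN [k zk]] : exists2 z, z \in N & exists k, iter k.+1 f z = z.
  have /trajectP[i lti eqi] := looping_order f x.
  exists (iter i f x); first exact: itN.
  by exists (fingraph.order f x - i).-1; rewrite prednK ?subn_gt0 // -iterD
    subnK // ltnW.
have /(orbitPcycle 3 5) f_inj : exists k, iter k.+1 f z = z by exists k.
have fzN y : y \in orbit f z -> y \in N.
  by rewrite -fconnect_orbit => /iter_findex <-; apply: itN.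
pose g y := if y \in orbit f z then f y else y.
have g_inj : injective g.
  move=> y y'; rewrite /g; case: ifP => yz; case: ifP => y'z //.
  - exact: f_inj.
  - by move=> fyy'; rewrite -fyy' mem_orbit in y'z.
  - by move=> yfy'; rewrite yfy' mem_orbit in yz.
have gE y : (perm g_inj y != y) = (y \in orbit f z).
  rewrite permE /g; case: ifP => [yz|_]; last by rewrite eqxx.
  by apply: contraTneq (Ef y (fzN y yz)) => ->; rewrite loopE.
have cg : is_cycle (perm g_inj).
  apply/and3P; split.
  - by apply: contraTneq (in_orbit f z) => g1; rewrite -gE g1 perm1 eqxx.
  - apply/'forall_implyP => y; rewrite inE gE permE /g => yz.
    by rewrite yz Ef // fzN.
  have zP y : y \in orbit f z -> y \in porbit (perm g_inj) z.
    rewrite -fconnect_orbit => /iter_findex <-.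
    apply/porbitP; exists (findex f z y).
    elim: (findex f z y) => [|m IHm]; first by rewrite expg0 perm1.
    by rewrite iterS IHm expgSr permM [RHS]permE /g -IHm -fconnect_orbit
      fconnect_iter.
  apply/'forall_implyP => y; rewrite inE gE => /zP.
  rewrite -eq_porbit_mem => /eqP->.
  by apply/subsetP => t; rewrite inE gE => /zP.
exists (exist is_cycle _ cg : cyc); apply/hike_le_stack => i.
case: (boolP (i \in supp (val (exist is_cycle _ cg : cyc)))) =>
  [ic|/stack_cyc_nsupp->];
  last exact: prefix0s.
have [a sa aE] := stack_cyc_supp ic; rewrite sa.
move: ic; rewrite SubK inE gE => iz.
have [b [l [sb bE]]] := fE i (fzN i iz); rewrite sb /=.
suff ->: a = b by rewrite eqxx prefix0s.
by apply: val_inj; rewrite aE bE SubK permE /g iz.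
Qed.

Lemma hike_bottom (h : hike E) : (forall y, h <= y)%O <-> h = 1.
Proof.
by split=> [/(_ 1)/hike_le1 //|-> y]; apply: hike1_le.
Qed.

(** Every non-trivial hike has a cycle below it ([cyc_below]), and distinct cycles are incomparable
    ([cyc_hike_le]). *)
Lemma atomP (h : hike_poset E) : atom h <-> exists c, h = cyc_hike c.
Proof.
split=> [[/hike_bottom/cyc_below[c ch]] /(_ _ ch)[/hike_bottom/cyc_hike_neq1
  //|<-]|].
  by exists c.
case=> c ->; split=> [/hike_bottom/cyc_hike_neq1 //|y yc].
case: (pselect (y = 1)) => [/hike_bottom|]; first by left.
move=> /cyc_below[d dy]; right; apply: le_anti; rewrite yc /=.
by rewrite -(cyc_hike_le (le_trans dy yc)).
Qed.

Lemma cyc_hike_compat c d :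
  (exists h : hike E, (cyc_hike c <= h)%O && (cyc_hike d <= h)%O) <->
  c = d \/ ~~ meets (supp (val c)) (supp (val d)).
Proof.
split=> [[h /andP[ch dh]]|[->|/cyc_hike_disjoint_ub//]].
  by case: (boolP (meets _ _)) => [/(cyc_hike_ub ch dh)|]; [left|right].
by exists (cyc_hike d); rewrite lexx.
Qed.

End Cycles.

Lemma meetsC (V : finType) (A B : {set V}) : meets A B = meets B A.
Proof. by apply: eq_existsb => x; rewrite andbC. Qed.

Lemma meets_supp (V : finType) (E : rel V) (c : cyc E) :
  meets (supp (val c)) (supp (val c)).
Proof. by have [x xc] := set0Pn _ (supp_neq0 c); apply/meetsP; exists x. Qed.

(** * From order isomorphisms to bijections of cycles *)

Section Transfer.
Variables (V V' : finType) (E : rel V) (E' : rel V').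
Hypotheses (loopE : irreflexive E) (loopE' : irreflexive E').

Lemma poset_iso_cyc : poset_iso (hike_poset E) (hike_poset E') ->
  exists phi : cyc E -> cyc E', bijective phi /\
  forall c d, meets (supp (val (phi c))) (supp (val (phi d)))
            = meets (supp (val c)) (supp (val d)).
Proof.
case=> F [[G FK GK] Fmono].
have Gmono : {mono G : x y / (x <= y)%O} by move=> x y; rewrite -Fmono !GK.
have atomF x : atom x -> atom (F x).
  case=> nx x_at; split=> [Fx|y yFx].
    by apply: nx => y; rewrite -Fmono Fx.
  have /x_at[Gy|Gyx] : (G y <= x)%O by rewrite -Fmono GK.
    by left=> z; rewrite -Gmono.
  by right; rewrite -Gyx GK.
have atomG x : atom x -> atom (G x).
  case=> nx x_at; split=> [Gx|y yGx].
    by apply: nx => y; rewrite -Gmono Gx.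
  have /x_at[Fy|Fyx] : (F y <= x)%O by rewrite -Gmono FK.
    by left=> z; rewrite -Fmono.
  by right; rewrite -Fyx FK.
have phiP c : exists c', F (cyc_hike loopE c) = cyc_hike loopE' c'.
  by apply/atomP/atomF/atomP; exists c.
have psiP c : exists c', G (cyc_hike loopE' c) = cyc_hike loopE c'.
  by apply/atomP/atomG/atomP; exists c.
have [phi phiE] := choice phiP; have [psi psiE] := choice psiP.
have phi_bij : bijective phi.
  exists psi => c.
    by apply: (cyc_hike_inj (loopE := loopE)); rewrite -psiE -phiE FK.
  by apply: (cyc_hike_inj (loopE := loopE')); rewrite -phiE -psiE GK.
exists phi; split=> // c d.
(* Equal cycles meet and yet have a common upper bound, so they are set apart. *)
case: (eqVneq c d) => [->|cd]; first by rewrite !meets_supp.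
apply/idP/idP; apply: contraTT => m.
  have [h] := (cyc_hike_compat loopE c d).2 (or_intror m).
  rewrite -(Fmono (cyc_hike _ c)) -(Fmono (cyc_hike _ d)) !phiE => hcd.
  have [/(bij_inj phi_bij) cd'|//] :=
    (cyc_hike_compat loopE' (phi c) (phi d)).1 (ex_intro _ (F h) hcd).
  by rewrite cd' eqxx in cd.
have [h] := (cyc_hike_compat loopE' (phi c) (phi d)).2 (or_intror m).
rewrite -!phiE -(Gmono _ h) -(Gmono (F (cyc_hike _ d)) h) !FK => hcd.
have [cd'|//] := (cyc_hike_compat loopE c d).1 (ex_intro _ (G h) hcd).
by rewrite cd' eqxx in cd.
Qed.

End Transfer.

(** * Preliminaries on finite sets and on edges *)

Section Involution.
Variables (T : finType) (f : T -> T).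
Hypothesis fK : involutive f.

Lemma card_involution_even (A : {set T}) :
  {in A, forall x, f x \in A} -> {in A, forall x, f x != x} -> ~~ odd #|A|.
Proof.
elim: {A}#|A| {-2}A (leqnn #|A|) => [|n IHn] A.
  by rewrite leqn0 => /eqP->.
move=> leAn fA fnx; have [->|[x xA]] := set_0Vmem A; first by rewrite cards0.
pose B := A :\ x :\ f x.
have cA : #|A| = #|B|.+2.
  by rewrite (cardsD1 x) xA (cardsD1 (f x) (A :\ x)) !inE fnx // fA.
rewrite cA /= negbK; apply: IHn.
- by move: leAn; rewrite cA => /ltnW.
- move=> y; rewrite !inE => /and3P[yfx yx yA].
  by rewrite fA // andbT (inj_eq (inv_inj fK)) yx -(inj_eq (inv_inj fK)) fK.
- by move=> y; rewrite !inE => /and3P[_ _ /fnx].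
Qed.

End Involution.

Section Refiber.
Variables (A B : finType) (T : eqType) (tA : A -> T) (tB : B -> T).
Variables (P : {set A}) (Q : {set B}).

(** When corresponding fibres have equal sizes, matching ranks in their enumerations is a bijection
    from [P] to [Q] over [T], inverted by the same construction ([refiberK]); the default [b0] is
    then never reached from [P]. *)
Definition refiber (b0 : B) (a : A) : B :=
  nth b0 (enum [set b in Q | tB b == tA a])
         (index a (enum [set a' in P | tA a' == tA a])).

Hypothesis cPQ :
  forall t, #|[set a in P | tA a == t]| = #|[set b in Q | tB b == t]|.

Lemma refiber_lt (a : A) : a \in P ->
  index a (enum [set a' in P | tA a' == tA a])
    < size (enum [set b in Q | tB b == tA a]).
Proof.
by move=> aP; rewrite -cardE -cPQ cardE index_mem mem_enum inE aP eqxx.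
Qed.

Lemma refiberP b0 a : a \in P ->
  refiber b0 a \in Q /\ tB (refiber b0 a) = tA a.
Proof.
move=> aP; have : refiber b0 a \in [set b in Q | tB b == tA a].
  by rewrite -mem_enum mem_nth ?refiber_lt.
by rewrite inE => /andP[-> /eqP->].
Qed.

End Refiber.

Lemma refiberK (A B : finType) (T : eqType) (tA : A -> T) (tB : B -> T)
    (P : {set A}) (Q : {set B}) a0 b0 :
  (forall t, #|[set a in P | tA a == t]| = #|[set b in Q | tB b == t]|) ->
  {in P, cancel (refiber tA tB P Q b0) (refiber tB tA Q P a0)}.
Proof.
move=> cPQ a aP; rewrite {1}/refiber (refiberP cPQ b0 aP).2.
rewrite index_uniq ?enum_uniq ?refiber_lt //.
by rewrite nth_index // mem_enum inE aP eqxx.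
Qed.

Section Graph.
Variables (V : finType) (E : rel V).
Hypotheses (symE : symmetric E) (loopE : irreflexive E).

Definition edges : {set {set V}} :=
  [set [set e.1; e.2] | e in [set e : V * V | E e.1 e.2]].

Lemma edgesP (A : {set V}) :
  reflect (exists x y, E x y /\ A = [set x; y]) (A \in edges).
Proof.
apply: (iffP imsetP) => [[[x y]]|[x [y [Exy ->]]]].
  by rewrite inE /= => Exy ->; exists x, y.
by exists (x, y); rewrite ?inE.
Qed.

Lemma edge_neq x y : E x y -> x != y.
Proof. by apply: contraTneq => ->; rewrite loopE. Qed.

Lemma edge_in x y : E x y -> [set x; y] \in edges.
Proof. by move=> Exy; apply/edgesP; exists x, y. Qed.

Lemma edges_at (A : {set V}) v :
  A \in edges -> v \in A -> exists2 x, E v x & A = [set v; x].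
Proof.
case/edgesP=> x [y [Exy ->]]; rewrite !inE => /orP[]/eqP->.
  by exists y.
by exists x; rewrite 1?symE // setUC.
Qed.

Lemma edges_at2 (A : {set V}) v w :
  A \in edges -> v \in A -> w \in A -> v != w -> E v w /\ A = [set v; w].
Proof.
move=> Ae vA; have [x Evx ->] := edges_at Ae vA.
by rewrite !inE => /orP[]/eqP->; rewrite ?eqxx.
Qed.

Lemma edges2 (A B : {set V}) v w : A \in edges -> B \in edges ->
  v \in A -> w \in A -> v \in B -> w \in B -> A != B -> v = w.
Proof.
move=> Ae Be vA wA vB wB; apply: contraNeq => vw.
by have [_ ->] := edges_at2 Ae vA wA vw; have [_ ->] := edges_at2 Be vB wB vw.
Qed.

Lemma edge_mem x y : [set x; y] \in edges -> x != y -> E x y.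
Proof.
move=> e xy.
by have [] := edges_at2 e (set21 x y) (set22 x y) xy.
Qed.

Hypothesis connE : forall x y, connect E x y.

Lemma connected_closed (A : {set V}) x : x \in A ->
  {in A, forall y z, E y z -> z \in A} -> forall z, z \in A.
Proof.
move=> xA clA z; have clE : fingraph.closed E (mem A).
  by move=> y t Eyt; apply/idP/idP => /clA; [|rewrite symE in Eyt]; apply.
by have := closed_connect clE (connE x z); rewrite xA => <-.
Qed.

Lemma edges_next (A B : {set V}) : A \in edges -> B \in edges -> A != B ->
  exists2 C, C \in edges & (C != A) && meets C A.
Proof.
move=> Ae Be AB; have /edgesP[x [y [Exy defA]]] := Ae.
case: (boolP [exists C in edges, (C != A) && meets C A]) => [|noC].
  by case/existsP=> C /andP[]; exists C.
have clA : {in A, forall v w, E v w -> w \in A}.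
  move=> v vA w Evw; apply: contraR noC => wA.
  apply/existsP; exists [set v; w]; rewrite edge_in //=.
  apply/andP; split; last by apply/meetsP; exists v; rewrite ?set21.
  by apply: contraNneq wA => <-; rewrite set22.
have xA : x \in A by rewrite defA set21.
have allA := connected_closed xA clA.
have /edgesP[z [t [Ezt defB]]] := Be.
have [_ AE] := edges_at2 Ae (allA z) (allA t) (edge_neq Ezt).
by rewrite AE defB eqxx in AB.
Qed.

End Graph.

Lemma digraph_iso_sym (V V' : finType) (E : rel V) (E' : rel V') :
  digraph_iso E E' -> digraph_iso E' E.
Proof.
by case=> f [[g fK gK] fmono]; exists g; split; [exists f | move=> x y;
  rewrite -fmono !gK].
Qed.

Lemma card_bij (A B : finType) : #|A| = #|B| -> exists f : A -> B, bijective f.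
Proof.
move=> cAB; exists (fun a => enum_val (cast_ord cAB (enum_rank a))).
exists (fun b => enum_val (cast_ord (esym cAB) (enum_rank b))) => x;
  by rewrite !enum_valK ?cast_ordK ?cast_ordKV enum_rankK.
Qed.

Lemma triangle_iso_complete3 (V : finType) (E : rel V) a b c :
    symmetric E -> irreflexive E -> E a b -> E b c -> E a c ->
    (forall x, x \in [:: a; b; c]) -> digraph_iso E (@complete 3).
Proof.
move=> symE loopE Eab Ebc Eac cover.
have EP x y : E x y = (x != y).
  apply/idP/idP => [/(edge_neq loopE) //|].
  move: (cover x) (cover y); rewrite !inE.
  by move=> /or3P[]/eqP-> /or3P[]/eqP->; rewrite ?eqxx // symE.
have u3 : uniq [:: a; b; c] by rewrite /= !inE negb_or -!EP Eab Ebc Eac.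
have [|f fbij] := @card_bij V 'I_3.
  rewrite card_ord -[3]/(size [:: a; b; c]) -(card_uniqP u3); apply: eq_card => x.
  by rewrite cover inE.
by exists f; split=> // x y; rewrite /complete EP (bij_eq fbij).
Qed.

(** * Counting the edges among twin cycles *)

Section CycleSystem.
Variables (V : finType) (E : rel V) (T : finType) (S : T -> {set V}).
Hypotheses (symE : symmetric E) (loopE : irreflexive E).
Hypothesis connE : forall x y, connect E x y.

(* The combinatorial properties of the supports of the simple cycles that     *)
(* determine which of them are edges; [rev] plays orientation reversal.       *)
Record cycle_system : Prop := CycleSystem {
  cs_edge : forall A, A \in edges E -> exists c, S c = A;
  cs_inj : forall c d, S c \in edges E -> S d = S c -> c = d;
  cs_rev : exists rev : T -> T, [/\ involutive rev, forall c, S (rev c) = S c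
    & forall c, S c \notin edges E -> rev c != c];
  cs_neq0 : forall c, S c != set0;
  cs_long : forall c, S c \notin edges E -> forall v, v \in S c ->
    exists x y, [/\ x \in S c, y \in S c, x != y, E v x & E v y] }.

Hypothesis CS : cycle_system.
Hypothesis nK3 : ~ digraph_iso E (@complete 3).

Definition meet_rel : rel T := fun c d => meets (S c) (S d).

(* A long cycle all of whose neighbours meet is a triangle spanning G.        *)
Lemma simplicial_edge c :
  (forall d d', meet_rel c d -> meet_rel c d' -> meet_rel d d') ->
  S c \in edges E.
Proof.
move=> simp; apply: contraT => cL; case: nK3.
have simpE x y z t : x \in S c -> z \in S c -> E x y -> E z t ->
    meets [set x; y] [set z; t].
  move=> xc zc /edge_in/(cs_edge CS)[d dE] /edge_in/(cs_edge CS)[d' d'E].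
  rewrite -dE -d'E; apply: simp; apply/meetsP.
    by exists x; rewrite // dE set21.
  by exists z; rewrite // d'E set21.
have [v vc] := set0Pn _ (cs_neq0 CS c).
have [x [y [xc yc xy Evx Evy]]] := cs_long CS cL vc.
have [z [zc Exz zv]] : exists z, [/\ z \in S c, E x z & z != v].
  have [z [t [zc tc zt Exz Ext]]] := cs_long CS cL xc.
  case: (eqVneq z v) => [zv|]; last by exists z.
  by exists t; rewrite -zv eq_sym.
(* The edges [v y] and [x z] both touch [c], hence meet, which leaves no other choice. *)
have yz : z = y.
  have /meetsP[t] := simpE _ _ _ _ vc xc Evy Exz.
  rewrite !inE => /orP[]/eqP->.
    by rewrite (negbTE (edge_neq loopE Evx)) eq_sym (negbTE zv).
  by rewrite eq_sym (negbTE xy) => /eqP.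
subst z; apply: (@triangle_iso_complete3 _ _ v x y) => //.
(* An edge at a corner must meet the opposite side, so no edge leaves the triangle. *)
have opp p q r t : p \in S c -> q \in S c -> E p t -> E q r -> p != q ->
    p != r -> (t == q) || (t == r).
  move=> pc qc Ept Eqr pq pr; have /meetsP[w] := simpE _ _ _ _ pc qc Ept Eqr.
  rewrite !inE => /orP[/eqP->|/eqP<-//].
  by rewrite (negbTE pq) (negbTE pr).
have vx := edge_neq loopE Evx; have vy := edge_neq loopE Evy.
have clA : {in [set p in [:: v; x; y]], forall p t, E p t -> t \in [set p in
  [:: v; x; y]]}.
  move=> p; rewrite !inE => /or3P[]/eqP-> t Et; rewrite !inE.
  - by rewrite (opp v x y) ?orbT.
  - by case/orP: (opp x v y t xc vc Et Evy (negbT (etrans (eq_sym _ _) (negbTE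
      vx))) xy) => ->; rewrite ?orbT.
  - by rewrite orbA (opp y v x t) // eq_sym.
move=> t; have := connected_closed symE connE (x := v) _ clA t.
by rewrite !inE eqxx => /(_ isT).
Qed.

Definition nbr (r : rel T) c := [set d | r c d].

Definition simplicial (r : rel T) (X : {set T}) :=
  [forall d in X, forall d' in X, r d d'].

(** The pattern left by a triangle hanging at one vertex: [s] stands for the side opposite to that
    vertex, [X] for the common neighbourhood of the other two sides. *)
Definition dominated (r : rel T) (X : {set T}) :=
  [exists s in X, simplicial r (nbr r s) &&
    [forall d in nbr r s, (d != s) ==> (X \subset nbr r d)]].

(* A simplicial class of twins consists of edges only. In any other class the *)
(* long cycles come in pairs of opposite orientations, so parity counts the   *)
(* edges up to 2, and the only classes with two edges are those described in  *)
(* [twin_edges], which [dominated] detects.                                   *)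
Definition edge_count (r : rel T) (X : {set T}) :=
  let n := #|[set c | nbr r c == X]| in
  if simplicial r X then n else if odd n then 1
  else if dominated r X && (n != 0) then 2 else 0.

Definition star (A : {set V}) : {set T} := [set d | meets A (S d)].

Lemma starS (A B : {set V}) : A \subset B -> star A \subset star B.
Proof.
move=> AB; apply/subsetP => d; rewrite !inE => /meetsP[x xA xd].
by apply/meetsP; exists x => //; apply: (subsetP AB).
Qed.

Lemma nbr_star c : nbr meet_rel c = star (S c).
Proof. by []. Qed.

Lemma simplicialP c : reflect
  (forall d d', meet_rel c d -> meet_rel c d' -> meet_rel d d')
  (simplicial meet_rel (nbr meet_rel c)).
Proof.
apply: (iffP forall_inP) => [H d d' cd cd'|H d].
  by have := H d; rewrite inE => /(_ cd)/forall_inP/(_ d'); rewrite inE; apply.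
by rewrite inE => cd; apply/forall_inP => d'; rewrite inE; apply: H.
Qed.

Lemma meet_relC c d : meet_rel c d = meet_rel d c.
Proof. exact: meetsC. Qed.

Lemma simplicial_edges c : simplicial meet_rel (nbr meet_rel c) -> S c \in edges E.
Proof. by move/simplicialP/simplicial_edge. Qed.

Lemma twin_edges_count c : #|[set d | nbr meet_rel d == nbr meet_rel c & S d
  \in edges E]|
  = #|[set A in edges E | star A == nbr meet_rel c]|.
Proof.
rewrite -(card_in_imset (f := S)); last first.
  move=> d d'; rewrite !inE => /andP[_ de] _ dd'.
  exact: (cs_inj CS de).
apply: eq_card => A; apply/imsetP/idP => [[d]|].
  by rewrite !inE => /andP[dX de] ->; rewrite de.
rewrite inE => /andP[Ae AX]; have [d dA] := cs_edge CS Ae.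
by exists d; rewrite // inE nbr_star dA AX.
Qed.

(** Reversal preserves supports, so it pairs off the long cycles within a class of twins. *)
Lemma twin_count_parity c : odd #|[set d | nbr meet_rel d == nbr meet_rel c]|
  = odd #|[set A in edges E | star A == nbr meet_rel c]|.
Proof.
rewrite -twin_edges_count -(cardsID [set d | S d \in edges E]) oddD addbC.
have [rev [revK revS rev_neq]] := cs_rev CS.
rewrite (negbTE (card_involution_even revK _ _)) /=.
- by congr (odd _); apply: eq_card => d; rewrite !inE.
- by move=> d; rewrite !inE !nbr_star revS.
- by move=> d; rewrite !inE => /andP[/rev_neq].
Qed.

(** If [c] is long, one of its edges at a vertex shared with [s] differs from [s]. That edge is a
    neighbour of [s], so it meets all of the class's neighbours; lying inside [c], it meets nothing
    else. *)
Lemma dominated_edge c :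
  dominated meet_rel (nbr meet_rel c) ->
  exists2 A, A \in edges E & star A = nbr meet_rel c.
Proof.
case/exists_inP => s; rewrite inE => cs /andP[/simplicial_edges se /forall_inP dom].
case: (boolP (S c \in edges E)) => [ce|cL]; first by exists (S c).
have /meetsP[x xc xs] := cs.
have [y [yc Exy ns]] : exists y, [/\ y \in S c, E x y & S s != [set x; y]].
  have [y [z [yc zc yz Exy Exz]]] := cs_long CS cL xc.
  case: (eqVneq (S s) [set x; y]) => [sE|]; last by exists y.
  exists z; split=> //; rewrite sE; apply: contraNneq yz => /setP/(_ y).
  by rewrite !inE eqxx orbT eq_sym (negbTE (edge_neq loopE Exy)) => /esym.
have [d dE] := cs_edge CS (edge_in Exy).
exists [set x; y]; rewrite ?edge_in //; apply/eqP; rewrite eqEsubset.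
rewrite starS /=; last by apply/subsetP => z; rewrite !inE => /orP[]/eqP->.
rewrite -dE; apply: (implyP (dom d _)).
  by rewrite inE; apply/meetsP; exists x; rewrite // dE set21.
by apply: contraNneq ns => <-; rewrite dE.
Qed.

(* Distinct edges with the same neighbours, not all of which meet, are        *)
(* the two sides [u v] and [u w] of a triangle that hangs on the rest of the  *)
(* graph at [u]; the third side [v w] is then the witness of [dominated].     *)
Lemma twin_edges c (A B : {set V}) :
  ~~ simplicial meet_rel (nbr meet_rel c) ->
  A \in edges E -> B \in edges E -> A != B ->
  star A = nbr meet_rel c -> star B = nbr meet_rel c ->
  dominated meet_rel (nbr meet_rel c) /\
  #|[set A in edges E | star A == nbr meet_rel c]| = 2.
Proof.
set X := nbr _ c => nsX Ae Be AB AX BX.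
have starE C : C \in edges E -> star C = X -> forall x t, E x t ->
    (x \in A) || (t \in A) -> meets C [set x; t].
  move=> _ CX x t /edge_in/(cs_edge CS)[d dE] xtA.
  suff: d \in star C by rewrite inE dE.
  rewrite CX -AX inE dE; apply/meetsP.
  by case/orP: xtA => ?; [exists x|exists t]; rewrite ?set21 ?set22.
have [u uA uB] : exists2 u, u \in A & u \in B.
  have /edgesP[x [y [Exy AE]]] := Ae.
  have /meetsP[u uB uA] : meets B [set x; y].
    by apply: starE; rewrite // AE set21.
  by exists u; rewrite // AE.
have [v Euv AE] := edges_at symE Ae uA; have [w Euw BE] := edges_at symE Be uB.
have uv := edge_neq loopE Euv; have uw := edge_neq loopE Euw.
have vw : v != w by apply: contraNneq AB => vw; rewrite AE BE vw.
(* An edge at [v] meets [A], hence also its twin [B]: besides [u], only [w] can be adjacent to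
   [v]. *)
have nbr_v t : E v t -> t != u -> t = w.
  move=> Evt tu; have /meetsP[y] : meets B [set v; t].
    by apply: starE; rewrite // AE set22.
  rewrite BE !inE => /orP[]/eqP->; first by rewrite (negbTE uv) eq_sym (negbTE tu).
  by rewrite eq_sym (negbTE vw) => /eqP.
have nbr_w t : E w t -> t != u -> t = v.
  move=> Ewt tu; have [d dE] := cs_edge CS (edge_in Ewt).
  have: d \in star B by rewrite inE dE BE; apply/meetsP; exists w;
    rewrite ?set21 ?set22.
  rewrite BX -AX inE dE AE => /meetsP[y].
  rewrite !inE => /orP[]/eqP->; first by rewrite (negbTE uw) eq_sym (negbTE tu).
  by rewrite (negbTE vw) => /eqP.
have at_v d : v \in S d -> (u \in S d) || (S d == [set v; w]).
  move=> vd; case: (boolP (S d \in edges E)) => [de|dL].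
    have [t Evt dE] := edges_at symE de vd; rewrite dE.
    case: (eqVneq t u) => [->|tu]; first by rewrite set22.
    by rewrite (nbr_v t) // eqxx orbT.
  have [x [y [xd yd xy Evx Evy]]] := cs_long CS dL vd.
  case: (eqVneq x u) => [<-|xu]; first by rewrite xd.
  case: (eqVneq y u) => [<-|yu]; first by rewrite yd.
  by rewrite (nbr_v x) // (nbr_v y) // eqxx in xy.
have at_w d : w \in S d -> (u \in S d) || (S d == [set v; w]).
  move=> wd; case: (boolP (S d \in edges E)) => [de|dL].
    have [t Ewt dE] := edges_at symE de wd; rewrite dE.
    case: (eqVneq t u) => [->|tu]; first by rewrite set22.
    by rewrite (nbr_w t) // setUC eqxx orbT.
  have [x [y [xd yd xy Ewx Ewy]]] := cs_long CS dL wd.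
  case: (eqVneq x u) => [<-|xu]; first by rewrite xd.
  case: (eqVneq y u) => [<-|yu]; first by rewrite yd.
  by rewrite (nbr_w x) // (nbr_w y) // eqxx in xy.
(* Without this edge, every neighbour of the class would pass through [u], and the class would be
   simplicial. *)
have Evw : E v w.
  apply: contraR nsX => nEvw.
  have uX d : d \in X -> u \in S d.
    rewrite -AX inE AE => /meetsP[y]; rewrite !inE => /orP[]/eqP-> // /[dup] vd.
    case/at_v/orP => // /eqP dE; have [_ _] := (dE, vd).
    have [dL|de] := boolP (S d \in edges E).
      by move: dL; rewrite dE => /(edge_mem symE)/(_ vw); rewrite (negbTE nEvw).
    have [x [z [xd zd xz Evx Evz]]] := cs_long CS de vd.
    have ux : x = u.
      by apply: contraNeq nEvw => /(nbr_v x Evx) <-.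
    by rewrite -ux.
  apply/forall_inP => d dX; apply/forall_inP => d' d'X.
  by apply/meetsP; exists u; apply: uX.
have [s sE] := cs_edge CS (edge_in Evw).
have se : S s \in edges E by rewrite sE edge_in.
have s_nbr d : d \in nbr meet_rel s -> d != s -> (u \in S d) && ((v \in S d) ||
  (w \in S d)).
  rewrite inE /meet_rel sE => /meetsP[y yvw yd] ds.
  have nd : S d != [set v; w].
    by apply: contraNneq ds => dE; apply/eqP/esym/(cs_inj CS se); rewrite sE.
  move: yvw; rewrite !inE => /orP[]/eqP yE; rewrite yE in yd.
    by have:= at_v d yd; rewrite (negbTE nd) orbF => ->; rewrite yd.
  by have:= at_w d yd; rewrite (negbTE nd) orbF => ->; rewrite yd orbT.
have s_simp : simplicial meet_rel (nbr meet_rel s).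
  apply/simplicialP => d d' sd sd'.
  case: (eqVneq d s) => [->//|ds]; case: (eqVneq d' s) => [->|d's].
    by rewrite meet_relC.
  have /andP[ud _] : (u \in S d) && ((v \in S d) || (w \in S d)).
    by apply: s_nbr; rewrite // inE.
  have /andP[ud' _] : (u \in S d') && ((v \in S d') || (w \in S d')).
    by apply: s_nbr; rewrite // inE.
  by apply/meetsP; exists u.
have s_sub d : d \in nbr meet_rel s -> d != s -> (A \subset S d) || (B \subset S d).
  move=> sd /(s_nbr d sd); rewrite AE BE !subUset !sub1set.
  by case: (u \in S d).
split.
  apply/exists_inP; exists s.
    by rewrite -/X -AX inE sE AE; apply/meetsP; exists v; rewrite ?set21 ?set22.
  rewrite s_simp; apply/forall_inP => d ds; apply/implyP => /(s_sub d ds).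
  by rewrite -/X nbr_star; case/orP => /starS; rewrite (AX, BX).
(* A further twin [C] meets [s] without being it, so it contains [A] or [B] and equals that edge. *)
have -> : [set A in edges E | star A == X] = [set A; B]; last by rewrite cards2 AB.
apply/setP => C; rewrite !inE; apply/andP/orP => [[Ce /eqP CX]|]; last first.
  by case=> /eqP->; rewrite (AX, BX).
have [d dE] := cs_edge CS Ce.
have ds : d != s.
  by apply: contraNneq nsX => ds; rewrite -CX -dE -nbr_star ds.
have sd : d \in nbr meet_rel s.
  rewrite inE meet_relC; suff: s \in star (S d) by rewrite inE.
  by rewrite dE CX -AX inE sE AE; apply/meetsP; exists v; rewrite ?set21 ?set22.
have := s_sub d sd ds; rewrite dE.
by case/orP => sub; [left | right]; rewrite eq_sym eqEcard sub;
  have /edgesP[x [y [/(edge_neq loopE) xy ->]]] := Ce;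
    rewrite (AE, BE) !cards2 ?uv ?uw xy.
Qed.

(** In a class that is not simplicial, a second edge forces domination and a total of two; otherwise
    there is at most one edge. Parity and [dominated_edge] decide the rest. *)
Lemma edge_countP c : #|[set A in edges E | star A == nbr meet_rel c]|
  = edge_count meet_rel (nbr meet_rel c).
Proof.
rewrite /edge_count; case: ifP => [simp|/negbT nsimp].
  rewrite -twin_edges_count; apply: eq_card => d; rewrite !inE.
  case: eqP => //= dc; apply: simplicial_edges; rewrite dc //.
have n0 : #|[set d | nbr meet_rel d == nbr meet_rel c]| != 0.
  by rewrite -lt0n; apply/card_gt0P; exists c; rewrite inE.
rewrite n0 andbT twin_count_parity.
set Y := [set A in edges E | _].
have le1 : ~~ dominated meet_rel (nbr meet_rel c) || (#|Y| != 2) -> #|Y| <= 1.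
  apply: contraTT; rewrite -ltnNge => /card_gt1P[A [B [AY BY AB]]].
  move: AY BY; rewrite !inE => /andP[Ae /eqP AX] /andP[Be /eqP BX].
  by have [-> ->] := twin_edges nsimp Ae Be AB AX BX.
case: ifP => [oddY|/negbT evenY].
  have/le1 : ~~ dominated meet_rel (nbr meet_rel c) || (#|Y| != 2).
    by rewrite orbC; case: eqP oddY => // ->.
  by case: #|Y| oddY => // -[].
case: ifP => [/dominated_edge[A Ae AX]|/negbT dom].
  have: 0 < #|Y| by apply/card_gt0P; exists A; rewrite inE Ae AX /=.
  case: (eqVneq #|Y| 2) => // Y2 Ygt0.
  have := le1 _; rewrite Y2 orbT => /(_ isT).
  by case: #|Y| Ygt0 evenY => [|[]].
have := le1 _; rewrite dom => /(_ isT).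
by case: #|Y| evenY => [|[]].
Qed.

Lemma star_count (X : {set T}) :
  #|[set A in edges E | star A == X]| = edge_count meet_rel X.
Proof.
case: (pickP (fun c => nbr meet_rel c == X)) => [c /eqP <-|noX].
  exact: edge_countP.
have n0 : #|[set c | nbr meet_rel c == X]| = 0.
  by apply: eq_card0 => c; rewrite inE noX.
rewrite /edge_count n0 /= andbF if_same.
apply: eq_card0 => A; rewrite inE; apply/andP => -[Ae /eqP AX].
by have [d dA] := cs_edge CS Ae; have := noX d; rewrite nbr_star dA AX eqxx.
Qed.

End CycleSystem.

(** * Line graph isomorphisms from cycle intersections *)

Section LineIso.
Variables (V V' : finType) (E : rel V) (E' : rel V').

(* [p] and [q] are unconstrained outside the edge sets.                       *)
Record line_iso (p : {set V} -> {set V'}) (q : {set V'} -> {set V}) : Prop :=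
  LineIso {
    li_in : {in edges E, forall A, p A \in edges E'};
    li_inV : {in edges E', forall A, q A \in edges E};
    li_K : {in edges E, cancel p q};
    li_KV : {in edges E', cancel q p};
    li_meets : {in edges E &, forall A B, meets (p A) (p B) = meets A B} }.

End LineIso.

Lemma line_iso_sym (V V' : finType) (E : rel V) (E' : rel V') p q :
  line_iso E E' p q -> line_iso E' E q p.
Proof.
case=> pin qin pK qK pm; split=> // A B Ae Be.
by rewrite -pm ?qin // !qK.
Qed.

Section SameIntersections.
Variables (V V' : finType) (E : rel V) (E' : rel V') (T : finType).
Variables (S : T -> {set V}) (S' : T -> {set V'}).
Hypotheses (symE : symmetric E) (loopE : irreflexive E).
Hypothesis connE : forall x y, connect E x y.
Hypotheses (symE' : symmetric E') (loopE' : irreflexive E').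
Hypothesis connE' : forall x y, connect E' x y.
Hypotheses (CS : cycle_system E S) (CS' : cycle_system E' S').
Hypothesis nK3 : ~ digraph_iso E (@complete 3).
Hypothesis nK3' : ~ digraph_iso E' (@complete 3).
Hypothesis SS' : meet_rel S = meet_rel S'.

(** The star of an edge already tells which edges it meets, so any matching of edges with equal
    stars will do. *)
Lemma same_intersections_line_iso : exists p q, line_iso E E' p q.
Proof.
have cEE' X : #|[set A in edges E | star S A == X]|
    = #|[set A in edges E' | star S' A == X]|.
  by rewrite (star_count symE loopE connE CS nK3)
    (star_count symE' loopE' connE' CS' nK3') SS'.
pose p := refiber (star S) (star S') (edges E) (edges E') set0.
pose q := refiber (star S') (star S) (edges E') (edges E) set0.
have pP A : A \in edges E -> p A \in edges E' /\ star S' (p A) = star S A.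
  exact: (refiberP cEE').
have qP A : A \in edges E' -> q A \in edges E /\ star S (q A) = star S' A.
  exact: (refiberP (fun X => esym (cEE' X))).
exists p, q; split=> [A /pP[]|A /qP[]|A|A|A B Ae Be] //.
- exact: (refiberK _ _ cEE').
- exact: (refiberK _ _ (fun X => esym (cEE' X))).
have [pAe pAS] := pP A Ae; have [pBe pBS] := pP B Be.
have [d dB] := cs_edge CS Be; have [e eA] := cs_edge CS' pAe.
have -> : meets A B = (d \in star S A) by rewrite inE dB.
rewrite -pAS inE -eA [RHS]meetsC -/(meet_rel S' d e) -SS' /meet_rel dB.
have -> : meets B (S e) = (e \in star S B) by rewrite inE.
by rewrite -pBS inE meetsC.
Qed.

End SameIntersections.

(** * Whitney's theorem on line graphs *)

Lemma four_vertex_iso (V V' : finType) (E : rel V) (E' : rel V') u x y z u' x'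
  y' z' :
  symmetric E -> irreflexive E -> symmetric E' -> irreflexive E' ->
  uniq [:: u; x; y; z] -> (forall t, t \in [:: u; x; y; z]) ->
  uniq [:: u'; x'; y'; z'] -> (forall t, t \in [:: u'; x'; y'; z']) ->
  [/\ E u x = E' u' x', E u y = E' u' y' & E u z = E' u' z'] ->
  [/\ E x y = E' x' y', E x z = E' x' z' & E y z = E' y' z'] ->
  digraph_iso E E'.
Proof.
move=> symE loopE symE' loopE' us cs us' cs' [ux uy uz] [xy xz yz].
set s := [:: u; x; y; z] in us cs; set s' := [:: u'; x'; y'; z'] in us' cs'.
pose f t := nth u' s' (index t s); pose g t := nth u s (index t s').
have lt_s t : index t s < 4 by rewrite -[4]/(size s) index_mem.
have lt_s' t : index t s' < 4 by rewrite -[4]/(size s') index_mem.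
have fK : cancel f g by move=> t; rewrite /f /g index_uniq ?nth_index.
have gK : cancel g f by move=> t; rewrite /f /g index_uniq ?nth_index.
have fE i : i < 4 -> f (nth u s i) = nth u' s' i by move=> i4;
  rewrite /f index_uniq.
have [fu fx fy fz] : [/\ f u = u', f x = x', f y = y' & f z = z'].
  by split; [apply: (fE 0) | apply: (fE 1) | apply: (fE 2) | apply: (fE 3)].
exists f; split=> [|r t]; first by exists g.
move: (cs r) (cs t); rewrite !inE.
by case/or4P=> /eqP-> /or4P[]/eqP->; rewrite ?fu ?fx ?fy ?fz ?loopE ?loopE' //
  symE symE'.
Qed.

Section Exceptional.
Variables (V V' : finType) (E : rel V) (E' : rel V').
Hypotheses (symE : symmetric E) (loopE : irreflexive E).
Hypothesis connE : forall x y, connect E x y.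
Hypotheses (symE' : symmetric E') (loopE' : irreflexive E').
Hypothesis connE' : forall x y, connect E' x y.
Hypothesis nK3' : ~ digraph_iso E' (@complete 3).
Variables (p : {set V} -> {set V'}) (q : {set V'} -> {set V}).
Hypothesis pq : line_iso E E' p q.

(* An edge meeting a triangle without being one of its sides meets exactly    *)
(* two of the sides; pulled back to the claw it joins two of its leaves. So   *)
(* both graphs have four vertices, the claw and the triangle completed by     *)
(* corresponding edges.                                                       *)
Lemma claw_to_triangle_iso u A B C :
  A \in edges E -> B \in edges E -> C \in edges E ->
  A != B -> A != C -> B != C -> u \in A -> u \in B -> u \in C ->
  (forall v, v \in p A -> v \in p B -> v \notin p C) -> digraph_iso E E'.
Proof.
move=> Ae Be Ce AB AC BC uA uB uC noABC.
have [x Eux AE] := edges_at symE Ae uA; have [y Euy BE] := edges_at symE Be uB.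
have [z Euz CE] := edges_at symE Ce uC.
have ux := edge_neq loopE Eux; have uy := edge_neq loopE Euy.
have uz := edge_neq loopE Euz.
have xy : x != y by apply: contraNneq AB => xy; rewrite AE BE xy.
have xz : x != z by apply: contraNneq AC => xz; rewrite AE CE xz.
have yz : y != z by apply: contraNneq BC => yz; rewrite BE CE yz.
have pe F : F \in edges E -> p F \in edges E' by apply: (li_in pq).
have qe F : F \in edges E' -> q F \in edges E by apply: (li_inV pq).
have pm F G : F \in edges E -> G \in edges E -> meets (p F) (p G) = meets F G.
  by move=> Fe Ge; apply: (li_meets pq).
have pI F G : F \in edges E -> G \in edges E -> p F = p G -> F = G.
  by move=> Fe Ge /(congr1 q); rewrite !(li_K pq).
have meet_at (F G : {set V}) v : v \in F -> v \in G -> meets F G.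
  by move=> vF vG; apply/meetsP; exists v.
have /meetsP[b bA bB] : meets (p A) (p B) by rewrite pm // (meet_at _ _ u).
have /meetsP[c cB cC] : meets (p B) (p C) by rewrite pm // (meet_at _ _ u).
have /meetsP[a aA aC] : meets (p A) (p C) by rewrite pm // (meet_at _ _ u).
have ab : a != b by apply: contraTneq aC => ->; apply: noABC.
have ac : a != c by apply: contraTneq aC => ac; apply: noABC; rewrite // ac.
have bc : b != c by apply: contraTneq cC => <-; apply: noABC.
have [Eab pAE] := edges_at2 symE' (pe A Ae) aA bA ab.
have [Ebc pBE] := edges_at2 symE' (pe B Be) bB cB bc.
have [Eac pCE] := edges_at2 symE' (pe C Ce) aC cC ac.
have meets2 (W : finType) (F : {set W}) r t : meets F [set r;
  t] = (r \in F) || (t \in F).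
  apply/meetsP/orP => [[w wF]|[]]; last 2 first.
  - by exists r; rewrite ?set21.
  - by exists t; rewrite ?set22.
  by rewrite !inE => /orP[]/eqP <-; [left|right].
pose other F := [&& F \in edges E, F != A, F != B & F != C].
(* The corner [a] lies on the images of [u x] and [u z], so an image passing through [a] comes from
   [x z]; likewise [b] encodes [x y] and [c] encodes [y z]. *)
have otherP F : other F -> [/\ u \notin F,
    (a \in p F) = (x \in F) && (z \in F), (b \in p F) = (x \in F) && (y \in F),
    (c \in p F) = (y \in F) && (z \in F)
    & [|| x \in F, y \in F | z \in F] -> [|| a \in p F, b \in p F | c \in p F]].
  case/and4P=> Fe FA FB FC.
  have nab : ~~ ((a \in p F) && (b \in p F)).
    apply: contra FA => /andP[aF bF]; apply/eqP/pI => //.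
    by have [_ ->] := edges_at2 symE' (pe F Fe) aF bF ab.
  have nbc : ~~ ((b \in p F) && (c \in p F)).
    apply: contra FB => /andP[bF cF]; apply/eqP/pI => //.
    by have [_ ->] := edges_at2 symE' (pe F Fe) bF cF bc.
  have nac : ~~ ((a \in p F) && (c \in p F)).
    apply: contra FC => /andP[aF cF]; apply/eqP/pI => //.
    by have [_ ->] := edges_at2 symE' (pe F Fe) aF cF ac.
  have := pm F A Fe Ae; have := pm F B Fe Be; have := pm F C Fe Ce.
  rewrite pAE pBE pCE AE BE CE !meets2 {pAE pBE pCE}.
  move: nab nbc nac.
  by case: (a \in p F); case: (b \in p F); case: (c \in p F) => //;
     case: (u \in F); case: (x \in F); case: (y \in F); case: (z \in F).
have other_sub F : other F -> [|| x \in F, y \in F | z \in F] ->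
    forall t, t \in F -> t \in [set t in [:: u; x; y; z]].
  move=> oF; have [uF aF bF cF /[apply]] := otherP F oF.
  have Fe : F \in edges E by case/andP: oF.
  rewrite aF bF cF => /or3P[]/andP[sF tF] t.
  - have [_ ->] := edges_at2 symE Fe sF tF xz.
    by rewrite !inE => /orP[]->; rewrite ?orbT.
  - have [_ ->] := edges_at2 symE Fe sF tF xy.
    by rewrite !inE => /orP[]->; rewrite ?orbT.
  - have [_ ->] := edges_at2 symE Fe sF tF yz.
    by rewrite !inE => /orP[]->; rewrite ?orbT.
have cover t : t \in [:: u; x; y; z].
  have := connected_closed symE connE (A := [set t in [:: u; x; y;
    z]]) (x := u) _ _ t.
  rewrite !inE eqxx => /(_ isT); apply=> s sX r Esr.
  have e := edge_in Esr; case: (boolP (other [set s; r])) => [o|].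
    have [uF _ _ _ _] := otherP _ o.
    apply: (other_sub _ o); last exact: set22.
    move: sX; rewrite !inE => /or4P[]/eqP sE.
    - by rewrite sE set21 in uF.
    - by rewrite sE eqxx.
    - by rewrite sE eqxx orbT.
    - by rewrite sE eqxx !orbT.
  rewrite /other e /= !negb_and !negbK.
  have rF := set22 s r.
  by case/or3P=> /eqP FE; move: rF; rewrite FE ?AE ?BE ?CE !inE => /orP[]->;
    rewrite ?orbT.
have two F : other F -> [|| a \in p F, b \in p F | c \in p F].
  move=> oF; have [uF _ _ _] := otherP F oF; apply.
  have /edgesP[r [t [_ FE]]] : F \in edges E by case/andP: oF.
  have rF : r \in F by rewrite FE set21.
  move: (cover r); rewrite !inE => /or4P[]/eqP rE; move: rF; rewrite rE => rF.
  - by rewrite rF in uF.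
  - by rewrite rF.
  - by rewrite rF orbT.
  - by rewrite rF !orbT.
have not_other F : F \in edges E -> ~~ other F -> p F \subset [set t in [:: a;
  b; c]].
  move=> Fe; rewrite /other Fe /= !negb_and !negbK.
  by case/or3P=> /eqP->; rewrite ?pAE ?pBE ?pCE subUset !sub1set !inE !eqxx ?orbT.
(* With no edge beyond the claw, [E'] would be a triangle. *)
case: (pickP other) => [F0 oF0|no_other]; last first.
  case: nK3'; apply: (@triangle_iso_complete3 _ _ a b c) => // t.
  have := connected_closed symE' connE' (A := [set t in [:: a; b;
    c]]) (x := a) _ _ t.
  rewrite !inE eqxx => /(_ isT); apply=> s _ r Esr.
  have D := edge_in Esr; have /subsetP := not_other (q [set s;
    r]) (qe _ D) (negbT (no_other _)).
  by rewrite (li_KV pq) //; apply; rewrite set22.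
have F0e : F0 \in edges E by case/andP: oF0.
have [d [s0 [s0abc dabc pF0E]]] : exists d s0, [/\ s0 \in [:: a; b; c],
    d \notin [:: a; b; c] & p F0 = [set s0; d]].
  have [s0 s0F s0abc] : exists2 s, s \in p F0 & s \in [:: a; b; c].
    case/or3P: (two F0 oF0) => sF; [exists a | exists b | exists c] => //;
    by rewrite !inE eqxx ?orbT.
  have [d Esd pF0E] := edges_at symE' (pe F0 F0e) s0F.
  exists d, s0; split=> //; apply: contraT => /negPn dabc.
  have s0d := edge_neq loopE' Esd.
  have [_ F0A F0B F0C] := and4P oF0.
  move: s0abc dabc s0d pF0E; rewrite !inE => /or3P[]/eqP-> /or3P[]/eqP->;
    rewrite ?eqxx //.
  - by rewrite -pAE => _ /(pI _ _ F0e Ae)/eqP; rewrite (negbTE F0A).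
  - by rewrite -pCE => _ /(pI _ _ F0e Ce)/eqP; rewrite (negbTE F0C).
  - by rewrite setUC -pAE => _ /(pI _ _ F0e Ae)/eqP; rewrite (negbTE F0A).
  - by rewrite -pBE => _ /(pI _ _ F0e Be)/eqP; rewrite (negbTE F0B).
  - by rewrite setUC -pCE => _ /(pI _ _ F0e Ce)/eqP; rewrite (negbTE F0C).
  - by rewrite setUC -pBE => _ /(pI _ _ F0e Be)/eqP; rewrite (negbTE F0B).
(* Two edges among the three leaves meet, hence so do their images. Were these to meet at a corner,
   that corner would encode both edges, making them equal; so they meet at [d]. *)
have other_d F : other F -> d \in p F.
  move=> oF; have Fe : F \in edges E by case/andP: oF.
  have [_ aF bF cF _] := otherP F oF; have [_ aF0 bF0 cF0 _] := otherP F0 oF0.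
  case: (eqVneq F F0) => [->|FF0]; first by rewrite pF0E set22.
  have : meets (p F) (p F0).
    rewrite pm //; move: (two F oF) (two F0 oF0); rewrite aF bF cF aF0 bF0 cF0.
    by case/or3P=> /andP[rF tF] /or3P[]/andP[rF0 tF0];
      first [exact: (meet_at _ _ x) | exact: (meet_at _ _ y) | exact: (meet_at
        _ _ z)].
  rewrite pF0E meets2 => /orP[s0F|//].
  have s0F0 : s0 \in p F0 by rewrite pF0E set21.
  suff FE : F = F0 by rewrite FE eqxx in FF0.
  have same r t : r != t -> (r \in F) && (t \in F) -> (r \in F0) && (t \in F0)
    -> F = F0.
    move=> rt /andP[rF tF] /andP[rF0 tF0].
    by have [_ ->] := edges_at2 symE Fe rF tF rt;
      have [_ ->] := edges_at2 symE F0e rF0 tF0 rt.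
  move: s0abc s0F s0F0; rewrite !inE => /or3P[]/eqP->.
  - by rewrite aF aF0; apply: same.
  - by rewrite bF bF0; apply: same.
  - by rewrite cF cF0; apply: same.
have [da db dc] : [/\ a != d, b != d & c != d].
  by move: dabc; rewrite !inE !negb_or => /and3P[]; rewrite ![d == _]eq_sym.
have link s r t : s \in [:: a; b; c] -> r != t -> u != r -> u != t ->
    (forall F, other F -> (s \in p F) = (r \in F) && (t \in F)) -> E' s d = E r t.
  move=> sabc rt ur ut sF; apply/idP/idP => [Esd|Ert].
    have De := edge_in Esd; have DK := li_KV pq De.
    have oF : other (q [set s; d]).
      apply: contraT => /not_other; rewrite DK qe // => /(_ isT)/subsetP/(_ d).
      by rewrite set22 inE (negbTE dabc) => /(_ isT).
    have := sF _ oF; rewrite DK set21 => /esym/andP[rF tF].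
    by have [] := edges_at2 symE (qe _ De) rF tF rt.
  have Fe := edge_in Ert.
  have oF : other [set r; t].
    have uF : u \notin [set r; t] by rewrite !inE negb_or ur.
    by rewrite /other Fe /=; apply/and3P; split; apply: contraNneq uF => ->.
  have sd : s != d by apply: contraNneq dabc => <-.
  have [] // := edges_at2 symE' (pe _ Fe) _ (other_d _ oF) sd.
  by rewrite sF // set21 set22.
have Ebd : E' b d = E x y.
  by apply: link => // [|F /otherP[]//]; rewrite !inE eqxx orbT.
have Ead : E' a d = E x z.
  by apply: link => // [|F /otherP[]//]; rewrite !inE eqxx.
have Ecd : E' c d = E y z.
  by apply: link => // [|F /otherP[]//]; rewrite !inE eqxx !orbT.
have cover' t : t \in [:: a; b; c; d].
  have := connected_closed symE' connE' (A := [set t in [:: a; b; c;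
    d]]) (x := a) _ _ t.
  rewrite !inE eqxx => /(_ isT); apply=> s sX r Esr.
  have De := edge_in Esr; have DK := li_KV pq De.
  case: (boolP (other (q [set s; r]))) => [oF|/not_other]; last first.
    rewrite DK qe // => /(_ isT)/subsetP/(_ r); rewrite set22 !inE => /(_ isT).
    by case/or3P=> ->; rewrite ?orbT.
  have dD := other_d _ oF; have := two _ oF; rewrite DK in dD *.
  have rD := set22 s r.
  case/or3P=> hD; [have [_ DE] := edges_at2 symE' De hD dD da
    | have [_ DE] := edges_at2 symE' De hD dD db
    | have [_ DE] := edges_at2 symE' De hD dD dc];
  by move: rD; rewrite DE !inE => /orP[]->; rewrite ?orbT.
have uniqV : uniq [:: u; x; y; z].
  by rewrite /= !inE !negb_or ux uy uz xy xz yz.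
have : [|| E x y, E x z | E y z].
  rewrite -Ebd -Ead -Ecd; move: (other_d _ oF0) (two _ oF0) => dF.
  by case/or3P=> hF; [have [-> _] := edges_at2 symE' (pe _ F0e) hF dF da
    | have [-> _] := edges_at2 symE' (pe _ F0e) hF dF db
    | have [-> _] := edges_at2 symE' (pe _ F0e) hF dF dc]; rewrite ?orbT.
have iso4 u' x' y' z' : (forall t, t \in [:: a; b; c; d] -> t \in [:: u'; x';
  y'; z']) ->
    [/\ E u x = E' u' x', E u y = E' u' y' & E u z = E' u' z'] ->
    [/\ E x y = E' x' y', E x z = E' x' z' & E y z = E' y' z'] ->
    digraph_iso E E'.
  move=> sub; apply: four_vertex_iso => // [|t]; last exact: sub.
  apply: (@leq_size_uniq _ [:: a; b; c; d]) => //.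
  by rewrite /= !inE !negb_or ab ac bc da db dc.
have fact := (Eux, Euy, Euz, Eab, Ebc, Eac, symE' b a, symE' c a, symE' c b,
  symE' d a, symE' d b, symE' d c, Ead, Ebd, Ecd).
(* The same three booleans, not all false, now describe both graphs. Claw and triangle complete to
   the same graph, a triangle with a pendant edge, K_4 minus an edge, or K_4; each pattern has its
   own relabelling. *)
case exy : (E x y) fact; case exz : (E x z); case eyz : (E y z) => // fact _;
  [ apply: (iso4 a b c d) | apply: (iso4 a b d c) | apply: (iso4 b d c a)
  | apply: (iso4 b a c d) | apply: (iso4 a d b c) | apply: (iso4 a b d c)
  | apply: (iso4 c d a b)];
  try (by split; rewrite ?fact ?exy ?exz ?eyz);
  by move=> t; rewrite !inE => /or4P[]->; rewrite ?orbT.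
Qed.

End Exceptional.

Section LineIsoStars.
Variables (V V' : finType) (E : rel V) (E' : rel V').
Hypotheses (symE : symmetric E) (loopE : irreflexive E).
Hypothesis connE : forall x y, connect E x y.
Hypotheses (symE' : symmetric E') (loopE' : irreflexive E').
Variables (p : {set V} -> {set V'}) (q : {set V'} -> {set V}).
Hypothesis pq : line_iso E E' p q.

(** Pairwise meeting edges without a common vertex form a triangle, so a line graph isomorphism
    fails this only by sending a claw to a triangle. *)
Definition preserves_claws (W W' : finType) (F : rel W) (f : {set W} -> {set W'}) :=
  forall u A B C, A \in edges F -> B \in edges F -> C \in edges F ->
  A != B -> A != C -> B != C -> u \in A -> u \in B -> u \in C ->
  exists v, [/\ v \in f A, v \in f B & v \in f C].

Lemma li_neq A B : A \in edges E -> B \in edges E -> A != B -> p A != p B.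
Proof.
by move=> Ae Be; apply: contraNneq => /(congr1 q); rewrite !(li_K pq) // => ->.
Qed.

Lemma star_image_sub v A B :
  preserves_claws E p -> A \in edges E -> B \in edges E -> A != B ->
  v \in A -> v \in B ->
  exists2 v', v' \in p A :&: p B & forall D, D \in edges E -> v \in D -> v' \in p D.
Proof.
move=> claw Ae Be AB vA vB.
have /meetsP[v' v'A v'B] : meets (p A) (p B).
  by rewrite (li_meets pq) //; apply/meetsP; exists v.
exists v'; first by rewrite inE v'A.
move=> D De vD; case: (eqVneq A D) => [<- //|AD]; case: (eqVneq B D) => [<- //|BD].
have [w [wA wB wD]] := claw v A B D Ae Be De AB AD BD vA vB vD.
by rewrite (edges2 symE' (li_in pq Ae) (li_in pq Be) v'A wA v'B wB) // li_neq.
Qed.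

End LineIsoStars.

(** Two edges at [v] single out [v'] as the common vertex of their images; going back by [q] returns
    to [v], the only vertex the two edges share. *)
Lemma star_image (V V' : finType) (E : rel V) (E' : rel V') p q v A B :
  symmetric E -> symmetric E' -> line_iso E E' p q ->
  preserves_claws E p -> preserves_claws E' q ->
  A \in edges E -> B \in edges E -> A != B -> v \in A -> v \in B ->
  exists v', forall D, D \in edges E -> (v \in D) = (v' \in p D).
Proof.
move=> symE symE' pq claw claw' Ae Be AB vA vB; have qp := line_iso_sym pq.
have [v'] := star_image_sub symE' pq claw Ae Be AB vA vB.
rewrite inE => /andP[v'A v'B] vv'.
have [w] := star_image_sub symE qp claw' (li_in pq Ae) (li_in pq Be)
  (li_neq pq Ae Be AB) v'A v'B.
rewrite !(li_K pq) // inE => /andP[wA wB] wv'.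
have wv : w = v := edges2 symE Ae Be wA vA wB vB AB.
exists v' => D De; apply/idP/idP => [|v'D]; first exact: vv'.
by rewrite -wv -(li_K pq De); apply: wv' => //; apply: (li_in pq).
Qed.

Section Whitney.
Variables (V V' : finType) (E : rel V) (E' : rel V').
Hypotheses (symE : symmetric E) (loopE : irreflexive E).
Hypothesis connE : forall x y, connect E x y.
Hypotheses (symE' : symmetric E') (loopE' : irreflexive E').

Lemma edge_at x y : E x y -> forall v, exists2 A, A \in edges E & v \in A.
Proof.
move=> Exy v; case: (pickP (E v)) => [t Evt|noE].
  by exists [set v; t]; rewrite ?edge_in ?set21.
have clv : {in [set v], forall s t, E s t -> t \in [set v]}.
  by move=> s; rewrite inE => /eqP-> t; rewrite noE.
have allv := connected_closed symE connE (set11 v) clv.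
by move: (allv x) (allv y) Exy; rewrite !inE => /eqP-> /eqP->; rewrite loopE.
Qed.

(** This adds the leaves: if [v] lies only on [A], the other end [u] of [A] has an image [u'] by
    [star_image], and [v] goes to the other end of [p A]. A second edge there would pull back to an
    edge at [u], so its image would also contain [u'] and coincide with [p A]. *)
Lemma star_image_all p q A0 B0 v :
  line_iso E E' p q -> preserves_claws E p -> preserves_claws E' q ->
  A0 \in edges E -> B0 \in edges E -> A0 != B0 ->
  exists v', forall D, D \in edges E -> (v \in D) = (v' \in p D).
Proof.
move=> pq claw claw' A0e B0e AB0; have qp := line_iso_sym pq.
have /edgesP[x0 [y0 [Exy _]]] := A0e; have [A Ae vA] := edge_at Exy v.
case: (boolP [exists B in edges E, (A != B) && (v \in B)]) => [|leaf].
  by case/exists_inP=> B Be /andP[AB vB];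
    apply: (star_image symE symE' pq claw claw' Ae Be).
have leafP D : D \in edges E -> v \in D -> D = A.
  move=> De vD; apply: contraNeq leaf => DA.
  by apply/exists_inP; exists D; rewrite // eq_sym DA.
have [u Evu AE] := edges_at symE Ae vA.
have [B [Be AB]] : exists B, B \in edges E /\ A != B.
  by case: (eqVneq A A0) => [->|]; [exists B0 | exists A0].
have [C Ce /andP[CA /meetsP[t tC tA]]] := edges_next symE loopE connE Ae Be AB.
have uC : u \in C.
  move: tA tC; rewrite AE !inE => /orP[]/eqP-> // vC.
  by rewrite (leafP C Ce vC) eqxx in CA.
have uA : u \in A by rewrite AE set22.
have [u' uE] := star_image symE symE' pq claw claw' Ce Ae CA uC uA.
have u'A : u' \in p A by rewrite -uE.
have [x' Eux pAE] := edges_at symE' (li_in pq Ae) u'A.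
have x'A : x' \in p A by rewrite pAE set22.
exists x' => D De; apply/idP/idP => [/(leafP D De)-> //|x'D].
apply: contraT => vD; have AD : A != D by apply: contraNneq vD => <-.
have [w wE] := star_image symE' symE qp claw' claw (li_in pq Ae) (li_in pq De)
  (li_neq pq Ae De AD) x'A x'D.
have wA : w \in A by rewrite -(li_K pq Ae) -wE // (li_in pq).
have wD : w \in D by rewrite -(li_K pq De) -wE // (li_in pq).
move: wA wD; rewrite AE !inE => /orP[]/eqP->; first by rewrite (negbTE vD).
rewrite uE // => u'D; have ux := edge_neq loopE' Eux.
have [_ pDE] := edges_at2 symE' (li_in pq De) u'D x'D ux.
by have := li_neq pq Ae De AD; rewrite pAE pDE eqxx.
Qed.

(** Distinct vertices on the same edges would be the two ends of an isolated edge. *)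
Lemma star_inj A0 B0 v w : A0 \in edges E -> B0 \in edges E -> A0 != B0 ->
  (forall D, D \in edges E -> (v \in D) = (w \in D)) -> v = w.
Proof.
move=> A0e B0e AB0 vw; apply/eqP; apply: contraT => neq_vw.
have /edgesP[x0 [y0 [Exy _]]] := A0e; have [A Ae vA] := edge_at Exy v.
have [_ AE] := edges_at2 symE Ae vA (etrans (esym (vw A Ae)) vA) neq_vw.
have [B [Be AB]] : exists B, B \in edges E /\ A != B.
  by case: (eqVneq A A0) => [->|]; [exists B0 | exists A0].
have [C Ce /andP[CA /meetsP[t tC tA]]] := edges_next symE loopE connE Ae Be AB.
have vC : v \in C.
  by move: tA tC; rewrite AE !inE => /orP[]/eqP->; rewrite ?(vw C).
have [_ CE] := edges_at2 symE Ce vC (etrans (esym (vw C Ce)) vC) neq_vw.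
by rewrite AE CE eqxx in CA.
Qed.

Lemma few_edges_complete : {in edges E &, forall A B, A = B} ->
  forall x y, E x y = (x != y).
Proof.
move=> few x y; apply/idP/idP => [/(edge_neq loopE)//|xy].
case: (pickP (E x)) => [z Exz|noE]; last first.
  have clx : {in [set x], forall s t, E s t -> t \in [set x]}.
    by move=> s; rewrite inE => /eqP-> t; rewrite noE.
  have := connected_closed symE connE (set11 x) clx y.
  by rewrite inE eq_sym (negbTE xy).
have clA : {in [set x; z], forall s t, E s t -> t \in [set x; z]}.
  by move=> s _ t Est; rewrite (few _ _ (edge_in Exz) (edge_in Est)) set22.
have := connected_closed symE connE (set21 x z) clA y.
by rewrite !inE eq_sym (negbTE xy) => /eqP->.
Qed.

(** This settles K_1 and K_2, the case in which stars do not separate vertices. *)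
Lemma few_edges_card : 0 < #|V| -> {in edges E &, forall A B, A = B} ->
  #|V| = #|edges E|.+1.
Proof.
move=> /card_gt0P[v _] few; have EP := few_edges_complete few.
case: (pickP (predC1 v)) => [w /= wv|all_v].
  have Evw : E v w by rewrite EP eq_sym.
  have ->: edges E = [set [set v; w]].
    apply/setP => A; rewrite inE; apply/idP/eqP => [Ae|->]; last exact: edge_in.
    exact: few Ae (edge_in Evw).
  rewrite cards1 -cardsT; suff -> : [set: V] = [set v;
    w] by rewrite cards2 eq_sym wv.
  apply/esym/setP => t; rewrite !inE; apply: contraT;
    rewrite negb_or => /andP[tv tw].
  have Evt : E v t by rewrite EP eq_sym.
  have := set22 v t; rewrite (few _ _ (edge_in Evt) (edge_in Evw)) !inE.
  by rewrite (negbTE tv) (negbTE tw).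
have allv t : t = v by have /negbFE/eqP := all_v t.
rewrite -cardsT; have -> : [set: V] = [set v].
  by apply/setP => t; rewrite !inE (allv t) eqxx.
rewrite cards1 (_ : edges E = set0) ?cards0 //; apply/setP => A; rewrite inE.
apply/negP => /edgesP[x [y [+ _]]].
by rewrite (allv x) (allv y) loopE.
Qed.

End Whitney.

Section WhitneyIso.
Variables (V V' : finType) (E : rel V) (E' : rel V').
Hypotheses (symE : symmetric E) (loopE : irreflexive E).
Hypothesis connE : connected E.
Hypotheses (symE' : symmetric E') (loopE' : irreflexive E').
Hypothesis connE' : connected E'.

Lemma claws_iso p q : line_iso E E' p q ->
  preserves_claws E p -> preserves_claws E' q -> digraph_iso E E'.
Proof.
move=> pq claw claw'; have qp := line_iso_sym pq.
have [V0 cE] := connE; have [V0' cE'] := connE'.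
case: (pickP (fun AB : {set V} * {set V} =>
    [&& AB.1 \in edges E, AB.2 \in edges E & AB.1 != AB.2])) => [[A B]|few].
  case/and3P=> /= Ae Be AB.
  have [f fE] := choice (fun v =>
    star_image_all symE loopE cE symE' loopE' v pq claw claw' Ae Be AB).
  have [g gE] := choice (fun v => star_image_all symE' loopE' cE' symE loopE v
    qp claw' claw (li_in pq Ae) (li_in pq Be) (li_neq pq Ae Be AB)).
  have f_inj : injective f.
    move=> v w fvw; apply: (star_inj symE loopE cE Ae Be AB) => D De.
    by rewrite !fE // fvw.
  have g_inj : injective g.
    move=> v w gvw.
    apply: (star_inj symE' loopE' cE' (li_in pq Ae) (li_in pq Be) (li_neq pq Ae
      Be AB)).
    by move=> D De; rewrite !gE // gvw.
  exists f; split=> [|x y].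
    by apply: (inj_card_bij f_inj); apply: leq_card g_inj.
  apply/idP/idP => [Exy|Exy].
    have De := edge_in Exy; have qDe := li_inV pq De.
    apply: (edges_at2 symE qDe _ _ _).1.
    - by rewrite fE // (li_KV pq) // set21.
    - by rewrite fE // (li_KV pq) // set22.
    - by apply: contraTneq Exy => ->; rewrite loopE'.
  have De := edge_in Exy.
  apply: (edges_at2 symE' (li_in pq De) _ _ _).1.
  - by rewrite -fE // set21.
  - by rewrite -fE // set22.
  - by rewrite (inj_eq f_inj) (edge_neq loopE).
have {}few : {in edges E &, forall A B, A = B}.
  by move=> A B Ae Be; have := few (A, B); rewrite /= Ae Be => /negbFE/eqP.
have few' : {in edges E' &, forall A B, A = B}.
  by move=> A B Ae Be; rewrite -(li_KV pq Ae) -(li_KV pq Be); congr p;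
    apply: few; apply: (li_inV pq).
have cee' : #|edges E| = #|edges E'|.
  rewrite -(card_in_imset (f := p)); last exact: can_in_inj (li_K pq).
  apply: eq_card => D; apply/imsetP/idP => [[A Ae ->]|De]; first exact: (li_in pq).
  by exists (q D); rewrite ?(li_KV pq) // (li_inV pq).
have [f f_bij] : exists f : V -> V', bijective f.
  by apply: card_bij; rewrite (few_edges_card symE) // (few_edges_card symE')
    // cee'.
exists f; split=> // x y.
by rewrite (few_edges_complete symE) // (few_edges_complete symE') // (bij_eq
  f_bij).
Qed.

(** Either claws are preserved both ways and stars give the vertex map, or some claw becomes a
    triangle and the graphs are small enough for [claw_to_triangle_iso]. *)
Theorem whitney p q : line_iso E E' p q ->
  ~ digraph_iso E (@complete 3) -> ~ digraph_iso E' (@complete 3) ->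
  digraph_iso E E'.
Proof.
move=> pq nK3 nK3'; have qp := line_iso_sym pq.
have [_ cE] := connE; have [_ cE'] := connE'.
case: (pselect (digraph_iso E E')) => // niso.
apply: (claws_iso pq) => [u A B C Ae Be Ce AB AC BC uA uB uC|].
  apply: contrapT => no; apply: niso.
  apply: (claw_to_triangle_iso symE loopE cE symE' loopE' cE' nK3' pq Ae Be Ce
    AB AC BC uA uB uC).
  by move=> v vA vB; apply/negP => vC; apply: no; exists v.
move=> u A B C Ae Be Ce AB AC BC uA uB uC.
apply: contrapT => no; apply/niso/digraph_iso_sym.
apply: (claw_to_triangle_iso symE' loopE' cE' symE loopE cE nK3 qp Ae Be Ce AB
  AC BC uA uB uC).
by move=> v vA vB; apply/negP => vC; apply: no; exists v.
Qed.

End WhitneyIso.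

(** * From hike posets to graphs *)

Section CycleSupports.
Local Open Scope group_scope.
Variables (V : finType) (E : rel V).
Hypotheses (symE : symmetric E) (loopE : irreflexive E).
Local Notation cycle_supp := (fun c : cyc E => supp (val c)).

Lemma supp_involution (c : cyc E) v : v \in supp (val c) ->
  val c (val c v) = v -> supp (val c) = [set v; val c v].
Proof.
move=> vc ccv; apply/eqP; rewrite eqEsubset; apply/andP; split.
  apply: subset_trans (cyc_orbit vc) _; apply/subsetP => _ /porbitP[k ->].
  elim: k => [|k]; first by rewrite expg0 perm1 set21.
  by rewrite expgSr permM !inE => /orP[]/eqP->; rewrite ?ccv eqxx ?orbT.
by rewrite subUset !sub1set vc supp_perm.
Qed.

Lemma long_not_involution (c : cyc E) v : supp (val c) \notin edges E ->
  v \in supp (val c) -> val c (val c v) != v.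
Proof.
move=> cL vc; apply: contraNneq cL => /(supp_involution vc) ->.
exact/edge_in/cyc_edge.
Qed.

Lemma tperm_is_cycle x y : E x y -> is_cycle E (tperm x y).
Proof.
move=> Exy; have xy := edge_neq loopE Exy.
have suppE z : z \in supp (tperm x y) -> z = x \/ z = y.
  by rewrite inE; case: tpermP; auto; rewrite eqxx.
apply/and3P; split.
- by apply: contraNneq xy => /permP/(_ x); rewrite tpermL perm1 => ->.
- by apply/forall_inP => z /suppE[]->; rewrite ?tpermL ?tpermR // symE.
- apply/forall_inP => z zs; apply/subsetP => t ts.
  have orb := mem_porbit (tperm x y) 1; rewrite expg1 in orb.
  have := orb z; case: (suppE z zs) => ->; case: (suppE t ts) => ->;
    by rewrite ?tpermL ?tpermR ?porbit_id.
Qed.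

Lemma inv_is_cycle (s : {perm V}) : is_cycle E s -> is_cycle E s^-1.
Proof.
have suppV : supp s^-1 = supp s.
  by apply/setP => x; rewrite !inE -(inj_eq (@perm_inj _ s)) permKV eq_sym.
case/and3P=> s1 /forall_inP sE /forall_inP sO; apply/and3P; split.
- by apply: contraNneq s1 => s1; rewrite -[s]invgK s1 invg1.
- apply/forall_inP => x xs; rewrite symE -[X in E _ X](permKV s).
  by apply: sE; rewrite -suppV supp_perm.
- by apply/forall_inP => x; rewrite suppV porbitV; apply: sO.
Qed.

Lemma cyc_system : cycle_system E cycle_supp.
Proof.
split.
- move=> A /edgesP[x [y [Exy ->]]]; exists (exist (is_cycle E) _
    (tperm_is_cycle Exy)).
  apply/setP => z; rewrite !inE /=; have xy := edge_neq loopE Exy.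
  case: tpermP => [->|->|/eqP zx /eqP zy].
  - by rewrite eqxx eq_sym xy.
  - by rewrite eqxx orbT xy.
  - by rewrite (negbTE zx) (negbTE zy) eqxx.
- move=> c d /edgesP[x [y [Exy cE]]] dE; rewrite cE in dE.
  have cxy (e : cyc E) : supp (val e) = [set x; y] -> val e x = y /\ val e y = x.
    move=> eE; have xe : x \in supp (val e) by rewrite eE set21.
    have ye : y \in supp (val e) by rewrite eE set22.
    have ex : val e x != x by move: xe; rewrite inE.
    have ey : val e y != y by move: ye; rewrite inE.
    move: (supp_perm xe) (supp_perm ye); rewrite eE !inE.
    by rewrite (negbTE ex) (negbTE ey) orbF => /eqP-> /eqP->.
  have [cx cy] := cxy c cE; have [dx dy] := cxy d dE.
  apply: (cyc_ext (x := x)); first by rewrite dE set21.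
  by move=> z; rewrite dE !inE => /orP[]/eqP->; rewrite ?cx ?cy ?dx ?dy.
- exists (fun c : cyc E => exist (is_cycle E) _ (inv_is_cycle (valP c)));
    split=> [c|c|c cL].
  + by apply: val_inj; rewrite /= invgK.
  + by apply/setP => x; rewrite !inE /= -(inj_eq (@perm_inj _ (val c))) permKV
      eq_sym.
  + have [x xc] := set0Pn _ (supp_neq0 c).
    apply: contraNneq (long_not_involution cL xc) => /(congr1 val)/= cV.
    by rewrite -{1}cV permK.
- exact: supp_neq0.
(* The successor and the predecessor of [v], which differ on a long cycle. *)
- move=> c cL v vc; exists (val c v), ((val c)^-1 v); split.
  + exact: supp_perm.
  + by rewrite inE permKV -(inj_eq (@perm_inj _ (val c))) permKV; move: vc;
      rewrite inE eq_sym.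
  + apply: contraNneq (long_not_involution cL vc) => ->; by rewrite permKV.
  + exact: cyc_edge.
  + rewrite symE -[X in E _ X](permKV (val c)); apply: cyc_edge.
    by rewrite inE permKV -(inj_eq (@perm_inj _ (val c))) permKV; move: vc;
      rewrite inE eq_sym.
Qed.

End CycleSupports.

(** Indexing the cycles of both graphs by one type turns preservation of intersections into an
    equality of relations. *)
Lemma cycle_system_bij (V : finType) (E : rel V) (T T' : finType)
    (S : T' -> {set V}) (f : T -> T') :
  bijective f -> cycle_system E S -> cycle_system E (S \o f).
Proof.
case=> g fK gK [edge inj [rev [revK revS rev_neq]] neq0 long]; split.
- by move=> A /edge[c <-]; exists (g c); rewrite /= gK.
- by move=> c d ce /inj/= cd; apply: (can_inj fK); apply: cd.
- exists (g \o rev \o f); split=> [c|c|c cL] /=.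
  + by rewrite gK revK fK.
  + by rewrite gK revS.
  + by apply: contraNneq (rev_neq _ cL) => /(congr1 f); rewrite gK => ->.
- by move=> c; apply: neq0.
- by move=> c; apply: long.
Qed.

(** * The exceptional graphs K_3 and K_{1,5} *)

(** On three vertices every non-identity permutation is a cycle, whence 3! - 1; disjoint supports
    would need four vertices. *)
Lemma complete3_cycles (V : finType) (E : rel V) :
  digraph_iso E (@complete 3) ->
  #|{: cyc E}| = 5 /\ forall c d : cyc E, meets (supp (val c)) (supp (val d)).
Proof.
case=> f [f_bij fE]; have cV : #|V| = 3 by rewrite (bij_eq_card f_bij) card_ord.
have EP x y : E x y = (x != y) by rewrite -fE /complete (bij_eq f_bij).
have not4 (x y z t : V) : uniq [:: x; y; z; t] -> False.
  move=> /card_uniqP /= u4; have := max_card (mem [:: x; y; z; t]).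
  by rewrite u4 cV.
have cycP (s : {perm V}) : is_cycle E s = (s != 1%g).
  rewrite /is_cycle; case: (eqVneq s 1%g) => //= _; apply/andP; split.
    by apply/forall_inP => x; rewrite inE EP eq_sym.
  apply/forall_inP => x xs; apply/subsetP => y ys; apply: contraT => yx.
  have orb z : porbit s (s z) = porbit s z by have := porbit_perm s 1 z;
    rewrite expg1.
  have sx : s x \in porbit s x by rewrite -eq_porbit_mem orb.
  have syx : s y \notin porbit s x by rewrite -eq_porbit_mem orb eq_porbit_mem.
  have dis p q : p \in porbit s x -> q \notin porbit s x -> p != q.
    by move=> px; apply: contraNneq => <-.
  case: (not4 x (s x) y (s y)); rewrite /= !inE !negb_or.
  move: xs ys; rewrite !inE => xs ys.
  by rewrite eq_sym xs (eq_sym y) ys !dis ?porbit_id.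
split=> [|c d].
  rewrite card_sig (eq_card (B := predC1 (1%g : {perm V}))) => [|s];
    last by rewrite inE cycP.
  rewrite cardC1 (_ : #|{perm V}| = 6) //; have := card_perm [set: V].
  rewrite cardsT cV -[3`!]/6 => <-; apply: eq_card => s; rewrite inE;
    apply/esym/subsetP => x.
  by rewrite !inE.
have [x xc] := set0Pn _ (supp_neq0 c); have [y yd] := set0Pn _ (supp_neq0 d).
apply: contraT => /existsPn dis; exfalso.
have ne p q : p \in supp (val c) -> q \in supp (val d) -> p != q.
  by move=> pc qd; apply: contraTneq qd => <-; have := dis p; rewrite pc.
have sxc := supp_perm xc; have syd := supp_perm yd.
have xx : x != val c x by move: xc; rewrite inE eq_sym.
have yy : y != val d y by move: yd; rewrite inE eq_sym.
by apply: (not4 x (val c x) y (val d y)); rewrite /= !inE !negb_or xx yy !ne.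
Qed.

(** Pairwise meeting edges form a star or a triangle, and a triangle has too few edges. *)
Lemma five_meeting_edges_star (V : finType) (E : rel V) :
  symmetric E -> irreflexive E -> (forall x y, connect E x y) ->
  #|edges E| = 5 -> {in edges E &, forall A B, meets A B} ->
  digraph_iso E (@complete_bipartite 1 5).
Proof.
move=> symE loopE connE c5 meetE.
have /card_gt1P[A [B [Ae Be AB]]] : 1 < #|edges E| by rewrite c5.
have /meetsP[a aA aB] := meetE A B Ae Be.
have [b Eab AE] := edges_at symE Ae aA; have [c Eac BE] := edges_at symE Be aB.
have ab := edge_neq loopE Eab; have ac := edge_neq loopE Eac.
have bc : b != c by apply: contraNneq AB => bc; rewrite AE BE bc.
have in_bc D : D \in edges E -> a \notin D -> D = [set b; c].
  move=> De aD.
  have bD : b \in D.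
    have /meetsP[t tD tA] := meetE D A De Ae; move: tA tD.
    by rewrite AE !inE => /orP[]/eqP-> //; rewrite (negbTE aD).
  have cD : c \in D.
    have /meetsP[t tD tA] := meetE D B De Be; move: tA tD.
    by rewrite BE !inE => /orP[]/eqP-> //; rewrite (negbTE aD).
  by have [_ ->] := edges_at2 symE De bD cD bc.
have allA D : D \in edges E -> a \in D.
  move=> De; apply: contraT => aD; have DE := in_bc D De aD.
  (* An edge avoiding [a] closes the triangle on [A] and [B], leaving three edges instead of
     five. *)
  have sub : edges E \subset [set A; B] :|: [set D].
    apply/subsetP => F Fe; rewrite !inE; case: (boolP (a \in F)) => [aF|/(in_bc
      F Fe)->].
      have [t Eat FE] := edges_at symE Fe aF.
      have /meetsP[s] := meetE F D Fe De; rewrite FE DE AE BE !inE.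
      case/orP=> /eqP->; first by rewrite (negbTE ab) (negbTE ac).
      by case/orP=> /eqP->; rewrite eqxx ?orbT.
    by rewrite DE eqxx !orbT.
  have := subset_leq_card sub; rewrite c5 => /leq_trans/(_ (leq_card_setU _ _)).
  by rewrite cards1 cards2; case: (_ != _).
have Ea t : t != a -> E a t.
  move=> ta; have [F Fe tF] := edge_at symE loopE connE Eab t.
  by have [] := edges_at2 symE Fe (allA F Fe) tF _; rewrite // eq_sym.
have card_a : #|[set~ a]| = 5.
  rewrite -c5 -(card_in_imset (f := fun t => [set a; t])).
    apply: eq_card => F; apply/imsetP/idP => [[t]|Fe].
      by rewrite !inE => ta ->; rewrite edge_in // Ea.
    have [t Eat ->] := edges_at symE Fe (allA F Fe); exists t => //.
    by rewrite !inE eq_sym (edge_neq loopE Eat).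
  move=> s t; rewrite !inE => sa ta /setP/(_ s).
  by rewrite !inE eqxx orbT (negbTE sa) => /esym/eqP.
pose g (x : 'I_1 + 'I_5) : V := match x with
  | inl _ => a | inr i => enum_val (cast_ord (esym card_a) i) end.
have g_neq i : g (inr i) != a.
  by have := enum_valP (cast_ord (esym card_a) i); rewrite !inE.
have g_inj : injective g.
  move=> [i|i] [j|j] /= e.
  - by rewrite !ord1.
  - by have := g_neq j; rewrite /= -e eqxx.
  - by have := g_neq i; rewrite /= e eqxx.
  - by move/enum_val_inj/cast_ord_inj: e => ->.
apply: digraph_iso_sym; exists g; split=> [|x y].
  apply: (inj_card_bij g_inj); rewrite card_sum !card_ord.
  by rewrite -(cardsC [set a]) cards1 card_a.
have notE s t : s != a -> t != a -> E s t = false.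
  move=> sa ta; apply/negP => /edge_in/allA.
  by rewrite !inE eq_sym (negbTE sa) eq_sym (negbTE ta).
case: x y => [i|i] [j|j]; rewrite /complete_bipartite /=.
- by rewrite loopE.
- by rewrite Ea // g_neq.
- by rewrite symE Ea // g_neq.
- by rewrite notE // g_neq.
Qed.

(** Since all cycles meet, each is simplicial; outside K_3, [simplicial_edge] makes all five of them
    edges. *)
Lemma complete3_partner (V V' : finType) (E : rel V) (E' : rel V')
    (phi : cyc E -> cyc E') :
  symmetric E -> irreflexive E -> (forall x y, connect E x y) ->
  bijective phi ->
  (forall c d, meets (supp (val (phi c))) (supp (val (phi d)))
            = meets (supp (val c)) (supp (val d))) ->
  digraph_iso E' (@complete 3) ->
  digraph_iso E (@complete 3) \/ digraph_iso E (@complete_bipartite 1 5).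
Proof.
move=> symE loopE connE phi_bij phi_meets /complete3_cycles[c5 meet5].
case: (pselect (digraph_iso E (@complete 3))) => nK3; [by left | right].
have CS := cyc_system symE loopE.
have meetE (c d : cyc E) : meets (supp (val c)) (supp (val d)) by rewrite
  -phi_meets.
have edgeE (c : cyc E) : supp (val c) \in edges E.
  by apply: (simplicial_edge symE loopE connE CS nK3) => d d' _ _; apply: meetE.
apply: five_meeting_edges_star => // [|A B /(cs_edge CS)[c <-] /(cs_edge CS)[d
  <-] //].
rewrite -c5 -(bij_eq_card phi_bij) -(card_imset (f := fun c : cyc E => supp
  (val c))).
  apply: eq_card => A; apply/idP/imsetP => [/(cs_edge CS)[c <-]|[c _ ->] //].
  by exists c.
by move=> c d cd; apply: (cs_inj CS (edgeE c)).
Qed.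

Theorem theorem4p3 (V V' : finType) (E : rel V) (E' : rel V')
    (bidirE : bidirected E) (loopE : loopless E) (connE : connected E)
    (bidirE' : bidirected E') (loopE' : loopless E') (connE' : connected E')
    (nK3 : ~ digraph_iso E (@complete 3))
    (nK15 : ~ digraph_iso E (@complete_bipartite 1 5)) :
  poset_iso (hike_poset E) (hike_poset E') -> digraph_iso E E'.
Proof.
move=> /(poset_iso_cyc loopE loopE')[phi [phi_bij phi_meets]].
have [_ cE] := connE; have [_ cE'] := connE'.
case: (pselect (digraph_iso E' (@complete 3))) => [K3'|nK3'].
  by case: (complete3_partner bidirE loopE cE phi_bij phi_meets K3').
have CS := cyc_system bidirE loopE.
have CS' := cycle_system_bij phi_bij (cyc_system bidirE' loopE').
have same_meet : meet_rel (fun c : cyc E => supp (val c))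
    = meet_rel ((fun c : cyc E' => supp (val c)) \o phi).
  by apply/funext => c; apply/funext => d; rewrite /meet_rel /= phi_meets.
have [p [q pq]] := same_intersections_line_iso bidirE loopE cE
  bidirE' loopE' cE' CS CS' nK3 nK3' same_meet.
exact: (whitney bidirE loopE connE bidirE' loopE' connE' pq nK3 nK3').
Qed.
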